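(* Fix an integer $k_{IJ}\ge0$. Suppose that for all $0\le k\le k_{IJ}+1$, $\gamma_n^{(k)}:=\sup_{\theta\in\Omega_\theta}\|d_\theta^kg_n(\theta)\|_\infty<\infty$ for all $n\ge1$ and $\sup_{n\ge1}\gamma_n^{(k)}<\infty$. For each $N$ let $\mathscr{W}_{loo}$ denote the set of all leave-one-out weight vectors $w_{(-n)}\in\mathbb{R}^N$, $n=1,\dots,N$ ($w_{(-n)}$ is $0$ in its $n$-th entry and $1$ otherwise). Suppose that the following hold for all $N$ and all $w\in\mathscr{W}_{loo}$, with constants that do not depend on $N$: (1) for each $\tilde w\in\Omega_w$ there is a solution $\hat\theta(\tilde w)$ of $G(\hat\theta(\tilde w),\tilde w)=0$ (one being fixed for each $\tilde w$), and the open set $\Omega_\theta\subseteq\mathbb{R}^D$ contains, for some $\epsilon>0$, every point at Euclidean distance less than $\epsilon$ from the convex hull of $\{\hat\theta(\tilde w):\tilde w\in\Omega_w\}$; (2) $g_0,\dots,g_N$ are $k_{IJ}+1$ times continuously differentiable on $\Omega_\theta$; (3) $H(\theta,1_N)$ is symmetric positive definite for all $\theta\in\Omega_\theta$ and $\sup_{\theta\in\Omega_\theta}\|H(\theta,1_N)^{-1}\|_{op}\le C_{op}<\infty$; (4) $\sup_{\theta\in\Omega_\theta}\|d_\theta^kG(\theta,1_N)\|_2\le M_k<\infty$ for $1\le k\le k_{IJ}+1$. Then, with probability one, as $N\to\infty$, $$\max_{w\in\mathscr{W}_{loo}}\big\|\hat\theta^{IJ}_{k_{IJ}}(w)-\h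at\theta(w)\big\|_2=O\big(N^{-(k_{IJ}+1)}\big).$$
   Context: $g_0,g_1,g_2,\dots$ are (random) functions of $\theta\in\mathbb{R}^D$ with values in $\mathbb{R}^D$, defined at least on the open set $\Omega_\theta$; ''with probability one'' refers to the randomness of the functions $g_n$. For each $N$ and $w\in\mathbb{R}^N$, $G(\theta,w):=\frac1N\big(g_0(\theta)+\sum_{n=1}^Nw_ng_n(\theta)\big)$. $1_N$ is the all-ones vector of length $N$. $d_\theta^kG(\theta,w)$ and $d_\theta^kg_n(\theta)$ are the arrays of all partial derivatives of order $k$ in $\theta$ ($d_\theta^0G=G$, $d_\theta^0g_n=g_n$), and $H(\theta,w):=d_\theta^1G(\theta,w)$. $\|\cdot\|_2$ and $\|\cdot\|_\infty$ of an array are the Euclidean and max norms of its vectorization; $\|\cdot\|_{op}$ is the matrix operator norm. For a given $w\in\mathbb{R}^N$ and an arbitrarily small scalar $\varepsilon>0$ (which may depend on $N$), $\Omega_w:=\{\tilde w\in\mathbb{R}^N:\|\tilde w-((1-t)1_N+tw)\|_2<\varepsilon\text{ for some }t\in[0,1]\}$. Write $\hat\theta:=\hat\theta(1_N)$ and $\Delta w:=w-1_N$. Let $\delta_w^k\hat\theta(1_N):=\sum_{n_1,\dots,n_k}\frac{\partial^k\hat\theta(w')}{\partial w'_{n_1}\cdots\partial w'_{n_k}}\big|_{w'=1_N}\Delta w_{n_1}\cdots\Delta w_{n_k}$, where the derivatives at $1_N$ are those of the locally unique solution branch of $G(\theta,w')=0$ through $(\hat\theta,1_N)$ (implicit function theorem;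 $H(\hat\theta,1_N)$ is invertible). The $k_{IJ}$-th order infinitesimal jackknife is $\hat\theta^{IJ}_{k_{IJ}}(w):=\hat\theta+\sum_{k=1}^{k_{IJ}}\frac1{k!}\delta_w^k\hat\theta(1_N)$, with $\hat\theta^{IJ}_0(w)=\hat\theta$. The set $\Omega_\theta$ does not depend on $N$. *)

(* Defs.v *)
From HB Require Import structures.
From mathcomp Require Import all_boot all_order all_algebra.
From mathcomp Require Import all_classical all_reals all_analysis.

Set Implicit Arguments.
Unset Strict Implicit.
Unset Printing Implicit Defensive.

Import Order.TTheory GRing.Theory Num.Theory.
Import numFieldNormedType.Exports.

Local Open Scope classical_set_scope.
Local Open Scope ring_scope.

(* The norm `|_| on matrices is the max norm, hence the explicit Euclidean
   norm. Arrays are functions on a finite index type. *)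
Definition norm2 (R : realType) (I : finType) (a : I -> R) : R :=
  Num.sqrt (\sum_i a i ^+ 2).

Definition norm_inf (R : realType) (I : finType) (a : I -> R) : R :=
  \big[Num.max/0]_i `|a i|.

Definition vnorm (R : realType) (m : nat) (v : 'rV[R]_m) : R := norm2 (v 0).

(* Extended-real valued, so that no boundedness proof is needed to unfold it. *)
Definition opnorm (R : realType) (m : nat) (A : 'M[R]_m) : \bar R :=
  ereal_sup [set (vnorm (A *m v^T)^T)%:E | v in [set v : 'rV[R]_m | vnorm v <= 1]].

Definition sym_posdef (R : realType) (m : nat) (A : 'M[R]_m) : Prop :=
  A^T = A /\ forall v : 'rV[R]_m, v != 0 -> 0 < (v *m A *m v^T) 0 0.

(* dpartial [:: i1; ...; ik] f = d_i1 (d_i2 (... (d_ik f))). *)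
Definition dpartial (R : realType) (m p : nat) (s : seq 'I_m)
    (f : 'rV[R]_m -> 'rV[R]_p) : 'rV[R]_m -> 'rV[R]_p :=
  foldr (fun i h x => 'D_(delta_mx 0 i) h x) f s.

(* Entry (s, i) of the array of order-k derivatives is the partial derivative
   along s of the i-th component. *)
Definition darray (R : realType) (m p k : nat) (f : 'rV[R]_m -> 'rV[R]_p)
    (x : 'rV[R]_m) : k.-tuple 'I_m * 'I_p -> R :=
  fun si => dpartial si.1 f x 0 si.2.

(* C^k on U (used for open U): the partial derivatives up to order k exist and
   are continuous at every point of U. The values of f outside U are
   irrelevant. *)
Definition Ck_on (R : realType) (m p k : nat) (U : set 'rV[R]_m)
    (f : 'rV[R]_m -> 'rV[R]_p) : Prop :=
  forall (s : seq 'I_m) (x : 'rV[R]_m), U x ->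
    ((size s < k)%N ->
       forall i : 'I_m, derivable (dpartial s f) x (delta_mx 0 i)) /\
    ((size s <= k)%N -> {for x, continuous (dpartial s f)}).

Definition convex_hull (R : realType) (m : nat) (A : set 'rV[R]_m) :
    set 'rV[R]_m :=
  smallest (@convex_set R 'rV[R]_m) A.

Definition contains_neighborhood (R : realType) (m : nat)
    (U A : set 'rV[R]_m) : Prop :=
  exists2 e : R, 0 < e &
    forall x y, A y -> vnorm (x - y) < e -> U x.

Definition ones (R : realType) (N : nat) : 'rV[R]_N := const_mx 1.

Definition loo (R : realType) (N : nat) (n : 'I_N) : 'rV[R]_N :=
  \row_j (j != n)%:R.

Definition Wloo (R : realType) (N : nat) : set 'rV[R]_N := range (@loo R N).

Definition Omega_w (R : realType) (N : nat) (eps : R) (w : 'rV[R]_N) :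
    set 'rV[R]_N :=
  [set w' | exists t : R, 0 <= t <= 1 /\
     vnorm (w' - ((1 - t) *: ones R N + t *: w)) < eps].

(* Entry w 0 n with n : 'I_N (counted from 0) is the weight of g n.+1; the
   unweighted function is g 0. *)
Definition G (R : realType) (D N : nat) (g : nat -> 'rV[R]_D -> 'rV[R]_D)
    (theta : 'rV[R]_D) (w : 'rV[R]_N) : 'rV[R]_D :=
  N%:R^-1 *: (g 0%N theta + \sum_(n < N) w 0 n *: g n.+1 theta).

(* The order-1 array of G as a matrix: row i is the gradient of the i-th
   component. *)
Definition H (R : realType) (D N : nat) (g : nat -> 'rV[R]_D -> 'rV[R]_D)
    (theta : 'rV[R]_D) (w : 'rV[R]_N) : 'M[R]_D :=
  \matrix_(i, j) darray (fun th => G g th w) theta ([tuple j], i).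

Definition gamma (R : realType) (D k : nat) (Omega : set 'rV[R]_D)
    (f : 'rV[R]_D -> 'rV[R]_D) : \bar R :=
  ereal_sup [set (norm_inf (darray (k := k) f theta))%:E | theta in Omega].

(* Near (theta0, w0), the zero set of G is the graph of the continuous
   function b. The germ of such a b at w0 is unique. *)
Definition solution_branch (R : realType) (D N : nat)
    (g : nat -> 'rV[R]_D -> 'rV[R]_D) (theta0 : 'rV[R]_D) (w0 : 'rV[R]_N)
    (b : 'rV[R]_N -> 'rV[R]_D) : Prop :=
  [/\ b w0 = theta0, {for w0, continuous b} &
      \forall z \near (theta0, w0), G g z.1 z.2 = 0 <-> z.1 = b z.2].

(* The default value of xget is irrelevant when a branch exists, as under the
   hypotheses of the implicit function theorem. *)
Definition branch (R : realType) (D N : nat)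
    (g : nat -> 'rV[R]_D -> 'rV[R]_D) (theta0 : 'rV[R]_D) (w0 : 'rV[R]_N) :
    'rV[R]_N -> 'rV[R]_D :=
  xget (fun=> theta0) [set b | solution_branch g theta0 w0 b].

(* delta_w^k of b at the all-ones vector, in the direction w - 1_N *)
Definition dirder (R : realType) (D N k : nat) (b : 'rV[R]_N -> 'rV[R]_D)
    (w : 'rV[R]_N) : 'rV[R]_D :=
  \sum_(t : k.-tuple 'I_N)
    (\prod_(n <- t) (w - ones R N) 0 n) *: dpartial t b (ones R N).

Definition theta_IJ (R : realType) (D N kIJ : nat)
    (g : nat -> 'rV[R]_D -> 'rV[R]_D) (theta1 : 'rV[R]_D) (w : 'rV[R]_N) :
    'rV[R]_D :=
  theta1 + \sum_(1 <= k < kIJ.+1)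
    (k`!)%:R^-1 *: dirder k (branch g theta1 (ones R N)) w.

(* Main.v *)
Require Import Defs.
From HB Require Import structures.
From mathcomp Require Import all_boot all_order all_algebra.
From mathcomp Require Import all_classical all_reals all_analysis.
From mathcomp Require Import ring lra.

Set Implicit Arguments.
Unset Strict Implicit.
Unset Printing Implicit Defensive.

Import Order.TTheory GRing.Theory Num.Theory.
Import numFieldNormedType.Exports.

Local Open Scope classical_set_scope.
Local Open Scope ring_scope.

(**
Leaving out observation n replaces the weights 1 by 1 - e_n.  Follow the
segment in between, with a parameter s that runs over [0, 1/N] rather than
[0, 1]: the weights are 1 - N s e_n, and the solution c(s) satisfies
  G(c(s), 1) = s g_n(c(s)),
an equation in which N occurs only through G(., 1), which is controlled
uniformly in N.  The two ends of the path are the full-data solution c(0) and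
the leave-one-out solution c(1/N), and the infinitesimal jackknife of order K
is the Taylor polynomial of c at 0 evaluated at 1/N.  As soon as the first
K + 1 derivatives of c are bounded by constants that depend neither on N nor
on n, Taylor's formula gives an error O((1/N)^(K+1)); the rate in N comes from
nothing but the length of the parameter interval.

Uniform bounds.  Differentiating the equation gives c' = A^-1 g_n(c) with
A = DG(c, 1) - s Dg_n(c).  By hypothesis DG(., 1) is symmetric positive
definite with smallest eigenvalue at least 1/Cop, and s Dg_n is a small
perturbation, so A is uniformly coercive (coercive_near_ones).  If the first k
derivatives of c are bounded, then so are those of A, of A^-1 (Cramer's rule)
and of g_n(c), hence of c'; this bootstrap (implicit_unif_diff) never needs a
formula for a higher derivative.  It is carried by the predicate unif_diff on
families of functions, the family here being indexed by all pairs (N, n).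

Regularity of the given solutions.  The selected solutions are chosen for each
weight vector separately.  Coercivity along the segment between two
solutions makes G(., w) strongly monotone there, and these segments stay in
Omega because the convex hull does; so the selected solution is Lipschitz in
the weights (hat_lipschitz).  The same inequality shows that it is the only
solution near the full-data one, so that it is itself the branch given by the
implicit function theorem (hat_solution_branch), and the derivatives in the
jackknife are those of the path c (dpartial_line, dirder_loo).  Since 1 - e_n
differs from 1 in one coordinate, only the pure partial derivatives in that
coordinate contribute.
*)

(** * Families of functions with uniformly bounded derivatives *)

Section UnifDiff.
Context (R : realType) (J : Type) (I : J -> set R).
Hypothesis I_open : forall j, open (I j).
Implicit Types f g : J -> R -> R.

Definition unif_bounded f := exists B : R, forall j s, I j s -> `|f j s| <= B.

(** The derivatives are existentially quantified instead of being the ones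
    computed by [derive1]: closure properties then follow by induction on [k]
    from the usual derivation rules, without rewriting under derivatives. *)
Fixpoint unif_diff (k : nat) f : Prop :=
  unif_bounded f /\
  if k is k'.+1 then
    exists f', (forall j s, I j s -> is_derive s (1 : R) (f j) (f' j s)) /\
               unif_diff k' f'
  else True.

Lemma unif_diff_bounded k f : unif_diff k f -> unif_bounded f.
Proof. by case: k => [|k] []. Qed.

Lemma unif_diffW k f : unif_diff k.+1 f -> unif_diff k f.
Proof.
elim: k f => [|k IHk] f [fB [f' [df f'k]]]; first by split.
by split=> //; exists f'; split=> //; exact: IHk.
Qed.

Lemma unif_diff_le k l f : (k <= l)%N -> unif_diff l f -> unif_diff k f.
Proof.
elim: l => [|l IHl]; first by rewrite leqn0 => /eqP ->.
rewrite leq_eqVlt => /predU1P[->//|kl] /unif_diffW; exact: IHl.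
Qed.

(** Openness of the domains makes the derivative at a point depend only on the
    values on the domain. *)
Lemma unif_diff_ext k f g : (forall j s, I j s -> f j s = g j s) ->
  unif_diff k f -> unif_diff k g.
Proof.
move=> fg; have bnd : unif_bounded f -> unif_bounded g.
  by move=> [B fB]; exists B => j s Is; rewrite -fg//; exact: fB.
case: k => [|k] [/bnd gB]; first by split.
move=> [f' [df f'k]]; split=> //; exists f'; split=> // j s Is.
apply: near_eq_is_derive (df _ _ Is); near=> t; apply: fg; near: t.
exact: open_nbhs_nbhs.
Unshelve. all: by end_near. Qed.

Lemma unif_diff_cst k (c : J -> R) : (exists B : R, forall j, `|c j| <= B) ->
  unif_diff k (fun j _ => c j).
Proof.
elim: k c => [|k IHk] c [B cB]; split=> //; try by exists B.
exists (fun _ _ => 0); split; last by apply: IHk; exists 0 => _; rewrite normr0.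
move=> j s _; exact: is_derive_cst.
Qed.

Lemma unif_diff_const k (c : R) : unif_diff k (fun _ _ => c).
Proof. by apply: unif_diff_cst; exists `|c|. Qed.

Lemma unif_diff_id k : (exists B : R, forall j s, I j s -> `|s| <= B) ->
  unif_diff k (fun _ s => s).
Proof.
case: k => [|k] bnd; split=> //; exists (fun _ _ => 1); split.
  by move=> j s _; exact: is_derive_id.
exact: unif_diff_const.
Qed.

Lemma unif_diffD k f g : unif_diff k f -> unif_diff k g ->
  unif_diff k (fun j s => f j s + g j s).
Proof.
have bnd u v : unif_bounded u -> unif_bounded v ->
    unif_bounded (fun j s => u j s + v j s).
  move=> [B uB] [C vC]; exists (B + C) => j s Is.
  by rewrite (le_trans (ler_normD _ _))// lerD ?uB ?vC.
elim: k f g => [|k IHk] f g [fB df] [gB dg]; split=> //; try exact: bnd.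
move: df dg => [f' [df f'k]] [g' [dg g'k]].
exists (fun j s => f' j s + g' j s); split; last exact: IHk.
by move=> j s Is; apply: is_deriveD; [exact: df|exact: dg].
Qed.

Lemma unif_boundedM f g : unif_bounded f -> unif_bounded g ->
  unif_bounded (fun j s => f j s * g j s).
Proof.
move=> [B fB] [C gC]; exists (B * C) => j s Is.
by rewrite normrM ler_pM ?fB ?gC.
Qed.

Lemma unif_diffM k f g : unif_diff k f -> unif_diff k g ->
  unif_diff k (fun j s => f j s * g j s).
Proof.
elim: k f g => [|k IHk] f g fk gk; have := fk; have := gk;
  move=> [gB dg] [fB df]; split=> //; try exact: unif_boundedM.
move: df dg => [f' [df f'k]] [g' [dg g'k]].
exists (fun j s => f j s * g' j s + g j s * f' j s); split.
  by move=> j s Is; apply: is_deriveM; [exact: df|exact: dg].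
by apply: unif_diffD; apply: IHk => //; exact: unif_diffW.
Qed.

Lemma unif_diffN k f : unif_diff k f -> unif_diff k (fun j s => - f j s).
Proof.
move=> fk; apply: (@unif_diff_ext _ (fun j s => (-1) * f j s)).
  by move=> j s _; rewrite mulN1r.
by apply: unif_diffM => //; exact: unif_diff_const.
Qed.

Lemma unif_diff_sum k (A : Type) (r : seq A) (P : pred A)
    (F : A -> J -> R -> R) :
  (forall a, unif_diff k (F a)) ->
  unif_diff k (fun j s => \sum_(a <- r | P a) F a j s).
Proof.
move=> Fk; elim: r => [|a r IHr].
  apply: (@unif_diff_ext _ (fun _ _ => 0)).
    by move=> j s _; rewrite big_nil.
  exact: unif_diff_const.
apply: (@unif_diff_ext _ (fun j s =>
    (P a)%:R * F a j s + \sum_(a <- r | P a) F a j s)).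
  by move=> j s _; rewrite big_cons; case: (P a); rewrite ?mul1r ?mul0r ?add0r.
apply: unif_diffD => //; apply: unif_diffM => //.
exact: unif_diff_const.
Qed.

Lemma unif_diff_prod k (A : Type) (r : seq A) (F : A -> J -> R -> R) :
  (forall a, unif_diff k (F a)) ->
  unif_diff k (fun j s => \prod_(a <- r) F a j s).
Proof.
move=> Fk; elim: r => [|a r IHr].
  apply: (@unif_diff_ext _ (fun _ _ => 1)).
    by move=> j s _; rewrite big_nil.
  exact: unif_diff_const.
apply: (@unif_diff_ext _ (fun j s => F a j s * \prod_(a <- r) F a j s)).
  by move=> j s _; rewrite big_cons.
exact: unif_diffM.
Qed.

Lemma unif_diff_det k m (A : J -> R -> 'M[R]_m) :
  (forall a b, unif_diff k (fun j s => A j s a b)) ->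
  unif_diff k (fun j s => \det (A j s)).
Proof.
move=> Ak; apply: unif_diff_sum => p; apply: unif_diffM.
  exact: unif_diff_const.
exact: unif_diff_prod.
Qed.

(** Together with [unif_diff_det] this is the regularity of the inverse matrix,
    via Cramer's rule. *)
Lemma unif_diff_adj k m (A : J -> R -> 'M[R]_m) :
  (forall a b, unif_diff k (fun j s => A j s a b)) ->
  forall a b, unif_diff k (fun j s => (\adj (A j s)) a b).
Proof.
move=> Ak a b.
apply: (@unif_diff_ext _
  (fun j s => (-1) ^+ (b + a) * \det (row' b (col' a (A j s))))).
  by move=> j s _; rewrite mxE.
apply: unif_diffM; first exact: unif_diff_const.
apply: unif_diff_det => i l.
by apply: unif_diff_ext (Ak (lift b i) (lift a l)) => j s _; rewrite !mxE.
Qed.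

(** Each derivative of [1 / f] is a polynomial in [1 / f] and the derivatives of
    [f], so a bound on [1 / f] bounds them all. *)
Lemma unif_diffV k f : (forall j s, I j s -> f j s != 0) ->
  unif_bounded (fun j s => (f j s)^-1) -> unif_diff k f ->
  unif_diff k (fun j s => (f j s)^-1).
Proof.
move=> f0 fVB; elim: k => [|k IHk] fk; split=> //.
have [_ [f' [df f'k]]] := fk.
exists (fun j s => - ((f j s)^-1 * (f j s)^-1 * f' j s)); split.
  move=> j s Is; have [dfs Dfs] := df j s Is.
  apply: DeriveDef; first by apply: derivableV => //; exact: f0.
  rewrite deriveV//; last exact: f0.
  by rewrite Dfs expr2 invfM /GRing.scale/= mulNr.
have IH := IHk (unif_diffW fk).
by apply: unif_diffN; apply: unif_diffM => //; exact: unif_diffM.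
Qed.

End UnifDiff.

(** * Functions of several variables with continuous partial derivatives *)

Section SeveralVariables.
Context (R : realType) (m : nat).
Implicit Types (x y v : 'rV[R]_m) (f : 'rV[R]_m -> R).

Lemma norm_coord v i : `|v 0 i| <= `|v|.
Proof.
rewrite [leRHS]/Num.Def.normr/= mx_normrE.
exact: (@le_bigmax _ _ _ 0 (fun ij : 'I_1 * 'I_m => `|v ij.1 ij.2|) (0, i)).
Qed.

Lemma norm_row_le v e : 0 <= e -> (forall i, `|v 0 i| <= e) -> `|v| <= e.
Proof.
move=> e0 ve; rewrite [leLHS]/Num.Def.normr/= mx_normrE.
by apply: bigmax_le => // -[i j] _ /=; rewrite ord1.
Qed.

(** Both difference quotients are the same function of the increment. *)
Lemma is_derive_lineP (V : normedModType R) (F : V -> R) (x v : V) (t dF : R) :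
  is_derive t (1 : R) (fun u => F (x + u *: v)) dF <->
  is_derive (x + t *: v) v F dF.
Proof.
have E : (fun h : R => h^-1 *:
      (((fun u => F (x + u *: v)) \o shift t) (h *: (1 : R)) -
       F (x + t *: v))) =
    (fun h : R => h^-1 *: ((F \o shift (x + t *: v)) (h *: v) - F (x + t *: v))).
  apply/funext => h /=; congr (_ *: (F _ - _)).
  by rewrite -[h *: (1 : R)]/(h * 1) mulr1 scalerDl addrCA.
by split=> -[dF1 dF2]; split; move: dF1 dF2; rewrite /derivable /derive E.
Qed.

(** Rescaling the segment to [0, 1] covers increments of either sign. *)
Lemma MVT_line (V : normedModType R) (F dF : V -> R) (x v : V) (a : R) :
  (forall t : R, `|t| <= `|a| ->
     is_derive (x + t *: v) v F (dF (x + t *: v))) ->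
  exists2 c : R, `|c| <= `|a| & F (x + a *: v) - F x = dF (x + c *: v) * a.
Proof.
move=> dFt.
have le_a (t : R) : t \in `[0, 1]%R -> `|a * t| <= `|a|.
  rewrite in_itv/= => /andP[t0 t1].
  by rewrite normrM (ger0_norm t0) ler_piMr.
pose phi t := F (x + (a * t) *: v).
have dphi (t : R) : t \in `[0, 1]%R ->
    is_derive t (1 : R) phi (dF (x + (a * t) *: v) * a).
  move=> t01.
  apply: (@is_derive1_comp _ (fun u => F (x + u *: v)) ( *%R a)).
    exact/is_derive_lineP/dFt/le_a.
  by apply: is_derive_eq; exact: mulr1.
have phic : {within `[0, 1], continuous phi}.
  by apply: derivable_within_continuous => t t01; have [] := dphi t t01.
have [c c01] := MVT_segment ler01 (fun t t01 => dphi t (subset_itv_oo_cc t01)) phic.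
rewrite subr0 mulr1 /phi mulr1 mulr0 scale0r addr0 => E.
by exists (a * c) => //; exact: le_a.
Qed.

(** Caratheodory's form of differentiability: the increment of [f] is linear in
    that of the argument, with coefficients that depend on the point and are
    continuous at [x].  Going from [x] to [y] one coordinate at a time, the mean
    value theorem provides each coefficient as a partial derivative at a point
    no farther from [x] than [y].  This form is convenient for the implicit
    function theorem below, since it turns a nonlinear equation into a linear
    system. *)
Lemma partial_slopes f (df : 'I_m -> 'rV[R]_m -> R) x :
  (\forall y \near x, forall i, is_derive y (delta_mx 0 i) f (df i y)) ->
  (forall i, {for x, continuous (df i)}) ->
  exists q : 'rV[R]_m -> 'I_m -> R,
    (forall i, q y i @[y --> x] --> df i x) /\
    \forall y \near x, f y - f x = \sum_i q y i * (y 0 i - x 0 i).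
Proof.
move=> /nbhs_ballP[r /= r0 dfr] dfc.
have near_ball_lt e : 0 < e -> \forall y \near x, `|y - x| < e.
  by move=> e0; apply/nbhs_ballP; exists e => // y; rewrite -ball_normE /= distrC.
have step y : exists xi : 'I_m -> 'rV[R]_m, `|y - x| < r ->
    (forall i, `|xi i - x| <= `|y - x|) /\
    f y - f x = \sum_i df i (xi i) * (y 0 i - x 0 i).
  have [yr|_] := ltP `|y - x| r; last by exists (fun=> x).
  pose p k : 'rV[R]_m := \row_j (if (j < k)%N then y 0 j else x 0 j).
  have pE (i : 'I_m) : p i.+1 = p i + (y 0 i - x 0 i) *: delta_mx 0 i.
    apply/rowP => j; rewrite !mxE eqxx/= ltnS leq_eqVlt.
    rewrite -[(j == i :> nat)]/(j == i).
    have [->|_] := eqVneq j i; first by rewrite ltnn mulr1 addrC subrK.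
    by rewrite mulr0 addr0.
  have near_p (i : 'I_m) t : `|t| <= `|y 0 i - x 0 i| ->
      `|p i + t *: delta_mx 0 i - x| <= `|y - x|.
    move=> tyx; have yxj j : `|y 0 j - x 0 j| <= `|y - x|.
      by have := norm_coord (y - x) j; rewrite !mxE.
    apply: norm_row_le => // j; rewrite !mxE eqxx/=.
    have [->|ji] := eqVneq j i.
      by rewrite ltnn mulr1 addrAC subrr add0r (le_trans tyx).
    by rewrite mulr0 addr0; case: ifP => // _; rewrite subrr normr0.
  have /choice[xi xiP] : forall i : 'I_m, exists z, `|z - x| <= `|y - x| /\
      f (p i.+1) - f (p i) = df i z * (y 0 i - x 0 i).
    move=> i; have dline (t : R) : `|t| <= `|y 0 i - x 0 i| ->
        is_derive (p i + t *: delta_mx 0 i) (delta_mx 0 i) f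
          (df i (p i + t *: delta_mx 0 i)).
      move=> tle; apply: dfr; rewrite -ball_normE /= distrC.
      exact: le_lt_trans (near_p _ _ tle) yr.
    have [c cle E] := MVT_line dline.
    by exists (p i + c *: delta_mx 0 i); split; [exact: near_p|rewrite pE].
  exists xi => _; split=> [i|]; first by have [] := xiP i.
  transitivity (\sum_(i < m) (f (p i.+1) - f (p i))).
    rewrite -(big_mkord xpredT (fun i => f (p i.+1) - f (p i))) telescope_sumr//.
    congr (f _ - f _); apply/rowP => j; rewrite mxE ?ltn_ord//.
  by apply: eq_bigr => i _; have [] := xiP i.
have [xi xiP] := choice step.
exists (fun y i => df i (xi y i)); split=> [i|].
  have xix : xi y i @[y --> x] --> x.
    apply/(@cvgrPdist_lt _ _ _ _ (nbhs_filter x)) => e e0.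
    apply: (@filterS _ _ (nbhs_filter x) _ _ _
      (near_ball_lt (Num.min e r) _)); last by rewrite lt_min e0.
    move=> y; rewrite lt_min => /andP[ye yr].
    by rewrite distrC (le_lt_trans ((xiP y yr).1 i)).
  exact: (cvg_comp _ _ xix (dfc i)).
by apply: filterS (near_ball_lt r r0) => y yr; exact: (xiP y yr).2.
Qed.

Lemma cvg_shift0 (s : R) : shift s (h *: (1 : R)) @[h --> 0^'] --> s.
Proof.
rewrite (_ : (fun h : R => _) = shift s); last first.
  by apply/funext => h; rewrite /shift/= [h *: _]mulr1.
apply: cvg_within_filter.
rewrite -[X in _ --> X]/(nbhs s) -{2}[s]add0r.
by apply: cvgD; [exact: cvg_id|exact: cvg_cst].
Qed.

(** Divide the identity of [partial_slopes] by the increment of the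
    parameter. *)
Lemma is_derive_curve f (df : 'I_m -> 'rV[R]_m -> R) (c : R -> 'rV[R]_m)
    (s : R) (dc : 'I_m -> R) :
  (\forall y \near c s, forall i, is_derive y (delta_mx 0 i) f (df i y)) ->
  (forall i, {for c s, continuous (df i)}) ->
  (forall i, is_derive s (1 : R) (fun t => c t 0 i) (dc i)) ->
  is_derive s (1 : R) (f \o c) (\sum_i df i (c s) * dc i).
Proof.
move=> fdf dfc cdc.
have [q [qdf fq]] := partial_slopes fdf dfc.
have cc : {for s, continuous c}.
  have : derivable c s 1.
    by apply/derivable_mxP => i j; rewrite ord1; have [] := cdc j.
  by move/derivable1_diffP/differentiable_continuous.
suff L : h^-1 *: ((f \o c \o shift s) (h *: (1 : R)) - (f \o c) s)
    @[h --> 0^'] -->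
    \sum_i df i (c s) * dc i.
  by split; [apply/cvg_ex; eexists; exact: L|exact/cvg_lim].
have csh : c (shift s (h *: (1 : R))) @[h --> 0^'] --> c s.
  exact: (cvg_comp _ _ (@cvg_shift0 s) cc).
have L : \sum_i q (c (shift s (h *: (1 : R)))) i *
    (h^-1 *: (c (shift s (h *: (1 : R))) 0 i - c s 0 i)) @[h --> 0^'] -->
    \sum_i df i (c s) * dc i.
  apply: (cvg_big add_continuous) => i _; apply: cvgM.
    exact: (cvg_comp _ _ csh (qdf i)).
  by have [dci <-] := cdc i; exact: dci.
have fq0 : \forall h \near 0^', f (c (shift s (h *: (1 : R)))) - f (c s) =
    \sum_i q (c (shift s (h *: (1 : R)))) i *
      (c (shift s (h *: (1 : R))) 0 i - c s 0 i) := csh _ fq.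
apply: cvg_trans L; apply: near_eq_cvg; near=> h.
rewrite /= (near fq0 h)//.
rewrite scaler_sumr; apply: eq_bigr => i _.
by rewrite [in LHS]/GRing.scale/= [in LHS]mulrCA.
Unshelve. all: by end_near. Qed.

End SeveralVariables.

(** * Taylor expansion with a uniform remainder *)

Section Taylor.
Context (R : realType) (J : Type) (I : J -> set R).
Hypothesis I_open : forall j, open (I j).
Implicit Types f : J -> R -> R.

Lemma derive1n_eq_open (U : set R) (u v : R -> R) k : open U ->
  (forall s, U s -> u s = v s) ->
  forall s, U s -> derive1n k u s = derive1n k v s.
Proof.
move=> Uo; elim: k u v => [|k IHk] u v uv s Us //; first by rewrite !derive1n0 uv.
rewrite !derive1Sn; apply: IHk Us => t Ut; rewrite !derive1E.
apply: near_eq_derive; near=> x; apply: uv; near: x; exact: open_nbhs_nbhs.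
Unshelve. all: by end_near. Qed.

(** As a [{poly R}], it can be differentiated formally. *)
Definition taylor_poly k (u : R -> R) : {poly R} :=
  \poly_(i < k.+1) (derive1n i u 0 / i`!%:R).

Lemma taylor_poly_at0 k u : (taylor_poly k u).[0] = u 0.
Proof. by rewrite horner_coef0 coef_poly/= fact0 divr1. Qed.

Lemma deriv_taylor_poly k u : (taylor_poly k.+1 u)^`() = taylor_poly k (derive1 u).
Proof.
apply/polyP => i; rewrite coef_deriv !coef_poly ltnS.
case: ifP => _; last by rewrite mul0rn.
rewrite -derive1Sn factS natrM invfM -[LHS]mulr_natr -mulrA; congr (_ * _).
by rewrite mulrAC mulVf ?mul1r// pnatr_eq0.
Qed.

(** The derivative of the remainder of order [k.+1] of [f] is the remainder of
    order [k] of [f'], so that the mean value theorem gains one power of [h] at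
    each step. *)
Lemma taylor_remainder k f f' :
  (forall j s, I j s -> is_derive s (1 : R) (f j) (f' j s)) ->
  unif_diff I k f' ->
  exists2 C : R, 0 <= C & forall j h, 0 <= h ->
    (forall s, 0 <= s <= h -> I j s) ->
    `|f j h - (taylor_poly k (f j)).[h]| <= C * h ^+ k.+1.
Proof.
have main k' f0 f0' (C : R) : 0 <= C ->
    (forall j s, I j s -> is_derive s (1 : R) (f0 j) (f0' j s)) ->
    (forall j h, 0 <= h -> (forall s, 0 <= s <= h -> I j s) ->
       `|f0' j h - ((taylor_poly k' (f0 j))^`()).[h]| <= C * h ^+ k') ->
    forall j h, 0 <= h -> (forall s, 0 <= s <= h -> I j s) ->
      `|f0 j h - (taylor_poly k' (f0 j)).[h]| <= C * h ^+ k'.+1.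
  move=> C0 df0 bnd j h h0 Ih.
  pose p := taylor_poly k' (f0 j).
  have dphi (t : R) : t \in `[0, h]%R ->
      is_derive t (1 : R) (f0 j \- horner p) (f0' j t - p^`().[t]).
    rewrite in_itv/= => t0h; have dft := df0 j t (Ih t t0h).
    exact: is_deriveB.
  have phic : {within `[0, h], continuous (f0 j \- horner p)}.
    by apply: derivable_within_continuous => t th; have [] := dphi t th.
  have [c] := MVT_segment h0 (fun t t01 => dphi t (subset_itv_oo_cc t01)) phic.
  rewrite in_itv/= => /andP[c0 ch].
  rewrite /= taylor_poly_at0 subrr !subr0 => ->.
  rewrite normrM (ger0_norm h0) exprSr mulrA ler_wpM2r//.
  apply: le_trans (bnd j c c0 _) _.
    by move=> s /andP[s0 sc]; apply: Ih; rewrite s0 (le_trans sc).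
  by rewrite ler_wpM2l// lerXn2r.
elim: k f f' => [|k IHk] f f' df f'k.
  have [B f'B] := unif_diff_bounded f'k.
  exists `|B|; first exact: normr_ge0.
  apply: main df _; first exact: normr_ge0.
  move=> j h h0 Ih; rewrite expr0 mulr1 /taylor_poly.
  rewrite (_ : (\poly_(i < 1) _)^`() = 0); last first.
    by apply/polyP => i; rewrite coef_deriv coef_poly coef0/= mul0rn.
  rewrite horner0 subr0 (le_trans (f'B _ _ _)) ?ler_norm//.
  by apply: Ih; rewrite h0 lexx.
have [_ [f'' [df' f''k]]] := f'k.
have [C C0 remf'] := IHk f' f'' df' f''k.
exists C => //; apply: (main _ _ f' C C0 df) => j h h0 Ih.
have -> : (taylor_poly k.+1 (f j))^`() = taylor_poly k (f' j); last exact: remf'.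
rewrite deriv_taylor_poly; apply/polyP => i; rewrite !coef_poly.
case: ifP => // _; congr (_ / _); apply: (@derive1n_eq_open (I j)) => //.
  by move=> s Is; rewrite derive1E; have [] := df j s Is.
by apply: Ih; rewrite lexx h0.
Qed.

End Taylor.

(** * Curves defined implicitly by a coercive system *)

Section Coercive.
Context (R : realType) (m : nat) (a : R) (A : 'M[R]_m).
Hypothesis a_gt0 : 0 < a.
Hypothesis A_coercive : forall v : 'rV[R]_m,
  a * \sum_i v 0 i ^+ 2 <= (v *m A *m v^T) 0 0.

Lemma sqr_coord_le (v : 'rV[R]_m) l : v 0 l ^+ 2 <= \sum_i v 0 i ^+ 2.
Proof. by rewrite (bigD1 l)//= lerDl sumr_ge0// => i _; exact: sqr_ge0. Qed.

(** A vector in the kernel would have a vanishing quadratic form. *)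
Lemma coercive_det_neq0 : \det A != 0.
Proof.
apply/negP => /det0P[v /eqP v0 vA]; apply: v0; apply/rowP => i.
have := A_coercive v; rewrite vA mul0mx mxE pmulr_rle0// => S0.
apply/eqP; rewrite mxE -sqrf_eq0 eq_le sqr_ge0 andbT.
exact: le_trans (sqr_coord_le v i) S0.
Qed.

(** A row [u] of the inverse satisfies [u A u^T = u_i], hence
    [a * |u|^2 <= |u_i| <= |u|]. *)
Lemma coercive_inv_le i l : `|invmx A i l| <= a^-1.
Proof.
have Au : A \in unitmx by rewrite unitmxE unitfE coercive_det_neq0.
pose u := row i (invmx A).
have uA : (u *m A *m u^T) 0 0 = u 0 i.
  rewrite -row_mul mulVmx// row1 -rowE.
  by rewrite !mxE.
have ub k : a * u 0 k ^+ 2 <= `|u 0 i|.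
  apply: le_trans (ler_norm _); rewrite -uA; apply: le_trans (A_coercive u).
  by rewrite ler_pM2l// sqr_coord_le.
have ui : `|u 0 i| <= a^-1.
  have [->|ui0] := eqVneq (u 0 i) 0; first by rewrite normr0 invr_ge0 ltW.
  have := ub i; rewrite -real_normK ?num_real// expr2 mulrA.
  rewrite -ler_pdivlMr ?normr_gt0// divff ?normr_eq0// => h.
  by rewrite -[leRHS]mul1r ler_pdivlMr// mulrC.
have -> : invmx A i l = u 0 l by rewrite mxE.
rewrite -(ler_pXn2r (n := 2)) ?nnegrE ?invr_ge0 ?(ltW a_gt0)// real_normK ?num_real//.
rewrite expr2 ler_pdivlMl//.
exact: le_trans (ub l) ui.
Qed.

End Coercive.

Section ImplicitCurve.
Context (R : realType) (m : nat) (Omega : set 'rV[R]_m).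
Hypothesis Omega_open : open Omega.

Local Notation partial i f := (dpartial [:: i] f).

Lemma dpartial_rcons (i : 'I_m) (f : 'rV[R]_m -> 'rV[R]_m) s :
  dpartial (rcons s i) f = dpartial s (partial i f).
Proof. by rewrite /dpartial foldr_rcons. Qed.

Lemma Ck_on_le k l (f : 'rV[R]_m -> 'rV[R]_m) : (k <= l)%N ->
  Ck_on l Omega f -> Ck_on k Omega f.
Proof.
move=> kl fC s x Ux; have [df cf] := fC s x Ux; split=> [sk|sk].
  by apply: df; exact: leq_trans kl.
by apply: cf; exact: leq_trans kl.
Qed.

Lemma Ck_on_partial k (f : 'rV[R]_m -> 'rV[R]_m) i :
  Ck_on k.+1 Omega f -> Ck_on k Omega (partial i f).
Proof.
move=> fC s x Ux; have [df cf] := fC (rcons s i) x Ux.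
by rewrite -dpartial_rcons; rewrite size_rcons in df cf.
Qed.

Lemma is_derive_partial (f : 'rV[R]_m -> 'rV[R]_m) (l : 'I_m) x :
  Ck_on 1 Omega f -> Omega x ->
  \forall y \near x, forall i,
    is_derive y (delta_mx 0 i) (fun z => f z 0 l) (partial i f y 0 l).
Proof.
move=> fC Ux; have : nbhs x Omega by exact: open_nbhs_nbhs.
apply: filterS => y Uy i.
have fi : derivable f y (delta_mx 0 i) by exact: (fC [::] y Uy).1.
split; first by move/derivable_mxP : fi => /(_ 0 l).
by rewrite /dpartial/= (derive_mx fi) mxE.
Qed.

Lemma continuous_partial (f : 'rV[R]_m -> 'rV[R]_m) (l : 'I_m) x i :
  Ck_on 1 Omega f -> Omega x ->
  {for x, continuous (fun y => partial i f y 0 l)}.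
Proof.
move=> fC Ux.
have fi : {for x, continuous (partial i f)} by exact: (fC [:: i] x Ux).2.
exact: (cvg_comp _ _ fi (@coord_continuous _ _ _ 0 l _)).
Qed.

Definition partial_mx (f : 'rV[R]_m -> 'rV[R]_m) x : 'M[R]_m :=
  \matrix_(i, l) partial l f x 0 i.

Context (J : Type) (I : J -> set R).
Hypothesis I_open : forall j, open (I j).
Hypothesis I_bounded : exists B : R, forall j s, I j s -> `|s| <= B.

Definition unif_Ck k (f : J -> 'rV[R]_m -> 'rV[R]_m) :=
  (forall j, Ck_on k Omega (f j)) /\
  forall s, (size s <= k)%N ->
    exists B : R, forall j x i, Omega x -> `|dpartial s (f j) x 0 i| <= B.

Lemma unif_Ck_le k l f : (k <= l)%N -> unif_Ck l f -> unif_Ck k f.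
Proof.
move=> kl [fC fB]; split=> [j|s sk]; first exact: Ck_on_le (fC j).
by apply: fB; exact: leq_trans kl.
Qed.

Lemma unif_Ck_partial k f i : unif_Ck k.+1 f ->
  unif_Ck k (fun j => partial i (f j)).
Proof.
move=> [fC fB]; split=> [j|s sk]; first exact: Ck_on_partial.
have [|B fsB] := fB (rcons s i); first by rewrite size_rcons.
by exists B => j x l Ux; rewrite -dpartial_rcons; exact: fsB.
Qed.

Variable c : J -> R -> 'rV[R]_m.
Hypothesis c_Omega : forall j s, I j s -> Omega (c j s).

(** By the chain rule the derivative is a sum of products of [f'(c)] and [c'],
    which allows induction on [k].  The curve is controlled through [dc] alone
    because it may drift to infinity inside [Omega] as the index of the family
    varies. *)
Lemma unif_diff_comp (dc : 'I_m -> J -> R -> R) k f :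
  (forall i j s, I j s ->
     is_derive s (1 : R) (fun t => c j t 0 i) (dc i j s)) ->
  (forall i, (0 < k)%N -> unif_diff I k.-1 (dc i)) ->
  unif_Ck k f -> forall l, unif_diff I k (fun j s => f j (c j s) 0 l).
Proof.
move=> cdc; elim: k f => [|k IHk] f dck fC l.
  by split=> //; have [B fB] := fC.2 [::] isT; exists B => j s Is; exact/fB/c_Omega.
split.
  by have [B fB] := fC.2 [::] isT; exists B => j s Is; exact/fB/c_Omega.
exists (fun j s => \sum_i partial i (f j) (c j s) 0 l * dc i j s); split.
  move=> j s Is; have fC1 : Ck_on 1 Omega (f j) by apply: Ck_on_le (fC.1 j).
  apply: (@is_derive_curve R m (fun x => f j x 0 l)
    (fun i x => partial i (f j) x 0 l) (c j) s (fun i => dc i j s)).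
  - by apply: is_derive_partial => //; exact: c_Omega.
  - by move=> i; apply: continuous_partial => //; exact: c_Omega.
  - by move=> i; exact: cdc.
apply: unif_diff_sum => // i; apply: unif_diffM => //; last exact: dck.
apply: (IHk (fun j => partial i (f j))) => [i' _|]; last exact: unif_Ck_partial.
exact: (unif_diff_le (leq_pred k) (dck i' isT)).
Qed.

Lemma cvg_det n (T : Type) (F : set_system T) (FF : Filter F)
    (A : T -> 'M[R]_n) (B : 'M[R]_n) :
  (forall i l, A x i l @[x --> F] --> B i l) ->
  \det (A x) @[x --> F] --> \det B.
Proof.
move=> AB; apply: (cvg_big add_continuous) => p _.
apply: cvgM; first exact: cvg_cst.
by apply: (cvg_big mul_continuous) => i _; exact: AB.
Qed.

Lemma cvg_adj n (T : Type) (F : set_system T) (FF : Filter F)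
    (A : T -> 'M[R]_n) (B : 'M[R]_n) :
  (forall i l, A x i l @[x --> F] --> B i l) ->
  forall i l, (\adj (A x)) i l @[x --> F] --> (\adj B) i l.
Proof.
move=> AB i l; rewrite mxE.
rewrite (_ : (fun x => (\adj (A x)) i l) = fun x => cofactor (A x) l i).
  apply: cvgM; first exact: cvg_cst.
  apply: cvg_det => u v; rewrite !mxE.
  rewrite (_ : (fun x => _) = fun x => A x (lift l u) (lift i v)); first exact: AB.
  by apply/funext => x; rewrite !mxE.
by apply/funext => x; rewrite mxE.
Qed.

Variables (F g : J -> 'rV[R]_m -> 'rV[R]_m) (a : R) (k : nat).
Hypothesis c_solves : forall j s, I j s -> F j (c j s) = s *: g j (c j s).
Hypothesis c_continuous : forall j s, I j s -> {for s, continuous (c j)}.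
Hypothesis F_C1 : forall j, Ck_on 1 Omega (F j).
Hypothesis F_Ck : forall i, unif_Ck k (fun j => partial i (F j)).
Hypothesis g_Ck : unif_Ck k.+1 g.

Let A j s := partial_mx (F j) (c j s) - s *: partial_mx (g j) (c j s).

Hypothesis a_gt0 : 0 < a.
Hypothesis A_coercive : forall j s (v : 'rV[R]_m), I j s ->
  a * \sum_i v 0 i ^+ 2 <= (v *m A j s *m v^T) 0 0.

Let velocity i j s :=
  (\det (A j s))^-1 * \sum_l (\adj (A j s)) i l * g j (c j s) 0 l.

(** Writing the increments of [F] and [g] as in [partial_slopes], the equation at
    two parameters becomes a linear system for the increment of [c], whose
    matrix tends to [A]; solving it by Cramer's rule and dividing by the
    increment [h] gives the limit. *)
Lemma is_derive_implicit i j s : I j s ->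
  is_derive s (1 : R) (fun t => c j t 0 i) (velocity i j s).
Proof.
move=> Is; set x := c j s; have Ux : Omega x by exact: c_Omega.
have gC1 : Ck_on 1 Omega (g j) by apply: Ck_on_le (g_Ck.1 j).
have /choice[qF qFP] l := partial_slopes (@is_derive_partial _ l _ (F_C1 j) Ux)
  (fun i => @continuous_partial _ l _ i (F_C1 j) Ux).
have /choice[qg qgP] l := partial_slopes (@is_derive_partial _ l _ gC1 Ux)
  (fun i => @continuous_partial _ l _ i gC1 Ux).
pose y h := c j (shift s (h *: (1 : R))).
have yx : y h @[h --> 0^'] --> x.
  exact: (cvg_comp _ _ (@cvg_shift0 R s) (c_continuous Is)).
(* The equations at the parameters [s + h] and [s], subtracted, read
   [Q h (y h - x) = h g (y h)]. *)
pose Q h := \matrix_(l, i') (qF l (y h) i' - s * qg l (y h) i').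
have QA l i' : Q h l i' @[h --> 0^'] --> A j s l i'.
  rewrite !mxE (_ : (fun h => _) =
    fun h => qF l (y h) i' - s * qg l (y h) i').
    apply: cvgB; first exact: (cvg_comp _ _ yx ((qFP l).1 i')).
    by apply: cvgM; [exact: cvg_cst|exact: (cvg_comp _ _ yx ((qgP l).1 i'))].
  by apply/funext => h; rewrite !mxE.
have A0 : \det (A j s) != 0.
  by apply: (coercive_det_neq0 a_gt0) => v; exact: A_coercive.
have detQ := @cvg_det _ _ _ (dnbhs_filter (0 : R)) _ _ QA.
have adjQ := @cvg_adj _ _ _ (dnbhs_filter (0 : R)) _ _ QA.
have gy l : g j (y h) 0 l @[h --> 0^'] --> g j x 0 l.
  have gx : {for x, continuous (g j)} by exact: (gC1 [::] x Ux).2.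
  exact: (cvg_comp _ _ yx (cvg_comp _ _ gx (@coord_continuous _ _ _ 0 l _))).
have L : (\det (Q h))^-1 * \sum_l (\adj (Q h)) i l * g j (y h) 0 l @[h --> 0^'] -->
    velocity i j s.
  apply: cvgM; first exact: cvgV.
  by apply: (cvg_big add_continuous) => l _; apply: cvgM.
suff L' : h^-1 *: (((fun t => c j t 0 i) \o shift s) (h *: (1 : R)) - x 0 i)
    @[h --> 0^'] --> velocity i j s.
  by split; [apply/cvg_ex; eexists; exact: L'|exact/cvg_lim].
apply: cvg_trans L; apply: near_eq_cvg.
have Is' : \forall h \near 0^', I j (shift s (h *: (1 : R))).
  by apply: (@cvg_shift0 R s _); exact: open_nbhs_nbhs.
have yF : \forall h \near 0^', forall l, F j (y h) 0 l - F j x 0 l =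
    \sum_i' qF l (y h) i' * (y h 0 i' - x 0 i').
  by apply: filter_forall => l; exact: (yx _ (qFP l).2).
have yg : \forall h \near 0^', forall l, g j (y h) 0 l - g j x 0 l =
    \sum_i' qg l (y h) i' * (y h 0 i' - x 0 i').
  by apply: filter_forall => l; exact: (yx _ (qgP l).2).
have Q0 : \forall h \near 0^', \det (Q h) != 0.
  exact: (detQ _ (open_nbhs_nbhs (conj (@open_neq _ 0) A0))).
near=> h.
have h0 : h != 0 by near: h; exact: nbhs_dnbhs_neq.
have QE : Q h *m (y h - x)^T = h *: (g j (y h))^T.
  apply/colP => l; rewrite !mxE.
  transitivity ((F j (y h) 0 l - F j x 0 l) - s * (g j (y h) 0 l - g j x 0 l)).
    rewrite (near yF h)// (near yg h)// mulr_sumr -sumrB.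
    by apply: eq_bigr => i' _; rewrite !mxE; ring.
  rewrite (c_solves Is) (c_solves (near Is' h _))// !mxE.
  by rewrite /y /x /shift/= ![h *: _]mulr1; ring.
have : (\det (Q h) *: (y h - x)^T) i 0 = (h *: (\adj (Q h) *m (g j (y h))^T)) i 0.
  by rewrite -mul_scalar_mx -mul_adj_mx -mulmxA QE scalemxAr.
rewrite !mxE => E.
have -> : \sum_l (\adj (Q h)) i l * g j (y h) 0 l =
    \sum_l (\adj (Q h)) i l * (g j (y h))^T l 0.
  by apply: eq_bigr => l _; rewrite [_^T _ _]mxE.
apply: (mulfI (mulf_neq0 h0 (near Q0 h _))) => //.
rewrite [in RHS]/GRing.scale/=.
have -> : h * \det (Q h) * (h^-1 * (y h 0 i - x 0 i)) =
  \det (Q h) * (y h 0 i - x 0 i) by field.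
rewrite E; field; exact: (near Q0 h).
Unshelve. all: by end_near. Qed.

(** One turn of the bootstrap: since [c' = A^-1 g(c)], bounds on the derivatives
    of [c] up to order [k'] give bounds on those of [c'] up to order [k']. *)
Let velocity_unif_diff k' : (k' <= k)%N ->
  (forall i, (0 < k')%N -> unif_diff I k'.-1 (velocity i)) ->
  forall i, unif_diff I k' (velocity i).
Proof.
move=> k'k vk i.
have comp f : unif_Ck k' f ->
    forall l, unif_diff I k' (fun j s => f j (c j s) 0 l).
  apply: (unif_diff_comp (dc := velocity)) => // l j s.
  exact: is_derive_implicit.
have Ak i' l : unif_diff I k' (fun j s => A j s i' l).
  apply: (@unif_diff_ext _ _ _ I_open _ (fun j s =>
    partial l (F j) (c j s) 0 i' + - (s * partial l (g j) (c j s) 0 i'))).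
    by move=> j s _; rewrite !mxE.
  apply: unif_diffD => //.
    exact/(comp (fun j => partial l (F j)))/(unif_Ck_le k'k).
  apply: unif_diffN => //; apply: unif_diffM => //; first exact: unif_diff_id.
  exact/(comp (fun j => partial l (g j)))/(unif_Ck_le k'k)/unif_Ck_partial.
have A0 j s : I j s -> \det (A j s) != 0.
  by move=> Is; apply: (coercive_det_neq0 a_gt0) => v; exact: A_coercive.
have detVB : unif_bounded I (fun j s => (\det (A j s))^-1).
  have [B invB] : unif_bounded I (fun j s => \det (invmx (A j s))).
    apply: (@unif_diff_bounded _ _ _ 0); apply: unif_diff_det => // i' l.
    split=> //; exists a^-1 => j s Is.
    by apply: coercive_inv_le => // v; exact: A_coercive.
  by exists B => j s Is; rewrite -det_inv; exact: invB.
apply: unif_diffM => //.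
  by apply: unif_diffV => //; exact: unif_diff_det.
apply: unif_diff_sum => // l; apply: unif_diffM => //.
  exact: unif_diff_adj.
by apply: comp; apply: unif_Ck_le g_Ck; exact: leqW.
Qed.

Lemma implicit_unif_diff : exists dc : 'I_m -> J -> R -> R,
  (forall i j s, I j s ->
     is_derive s (1 : R) (fun t => c j t 0 i) (dc i j s)) /\
  forall i, unif_diff I k (dc i).
Proof.
exists velocity; split=> [i j s|]; first exact: is_derive_implicit.
suff main k' : (k' <= k)%N -> forall i, unif_diff I k' (velocity i) by exact: main.
elim: k' => [|k' IHk] k'k i; apply: velocity_unif_diff => // l _.
exact/IHk/ltnW.
Qed.

End ImplicitCurve.

(** * Linear combinations of smooth maps and the Euclidean norm *)

Section LinearCombination.
Context (R : realType) (m : nat) (Omega : set 'rV[R]_m).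
Hypothesis Omega_open : open Omega.
Context (p : nat) (a : 'I_p -> R) (h : 'I_p -> 'rV[R]_m -> 'rV[R]_m) (k : nat).
Hypothesis hC : forall n, Ck_on k Omega (h n).

Let f x := \sum_n a n *: h n x.

Let dpartial_term n s x (i : 'I_m) : (size s < k)%N -> Omega x ->
  is_derive x (delta_mx 0 i) (a n *: dpartial s (h n))
    (a n *: dpartial (i :: s) (h n) x).
Proof.
by move=> sk Ux; apply: is_deriveZ; apply: derivableP; exact: (hC n s Ux).1.
Qed.

Let lincombE s : (fun x => \sum_n a n *: dpartial s (h n) x) =
  \sum_n a n *: dpartial s (h n).
Proof. by apply/funext => x; rewrite fct_sumE. Qed.

Lemma dpartial_lincomb s x : (size s <= k)%N -> Omega x ->
  dpartial s f x = \sum_n a n *: dpartial s (h n) x.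
Proof.
elim: s x => [//|i s IHs] x sk Ux.
transitivity ('D_(delta_mx 0 i) (fun y => \sum_n a n *: dpartial s (h n) y) x).
  apply: near_eq_derive; have : nbhs x Omega by exact: open_nbhs_nbhs.
  by apply: filterS => y Uy; apply: IHs => //; exact: ltnW.
rewrite lincombE; have dsum := is_derive_sum (fun n => dpartial_term n i sk Ux).
exact: (derive_val (is_derive := dsum)).
Qed.

Lemma Ck_on_lincomb : Ck_on k Omega f.
Proof.
move=> s x Ux; have nearU : nbhs x Omega by exact: open_nbhs_nbhs.
have E : (size s <= k)%N ->
    \forall y \near x, \sum_n a n *: dpartial s (h n) y = dpartial s f y.
  by move=> sk; apply: filterS nearU => y Uy; rewrite dpartial_lincomb.
split=> [sk i|sk].
  apply: near_eq_derivable (E (ltnW sk)) _; rewrite lincombE.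
  by have [] := is_derive_sum (fun n => dpartial_term n i sk Ux).
have L : \sum_n a n *: dpartial s (h n) y @[y --> x] -->
    \sum_n a n *: dpartial s (h n) x.
  apply: (@cvg_big _ _ _ _ _ add_continuous _ _ _ _ _ (nbhs_filter x)) => n _.
  apply: (@cvgZ _ _ _ _ (nbhs_filter x)); first exact: cvg_cst.
  exact: (hC n s Ux).2.
rewrite -(dpartial_lincomb sk Ux) in L.
exact: (cvg_trans (near_eq_cvg (E sk)) L).
Qed.

End LinearCombination.

Section EuclideanNorm.
Context (R : realType) (m : nat).
Implicit Types v : 'rV[R]_m.

Lemma vnorm_ge0 v : 0 <= vnorm v.
Proof. exact: sqrtr_ge0. Qed.

Lemma vnorm_sqr v : vnorm v ^+ 2 = \sum_i v 0 i ^+ 2.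
Proof. by rewrite sqr_sqrtr// sumr_ge0// => i _; exact: sqr_ge0. Qed.

Lemma vnormZ c v : vnorm (c *: v) = `|c| * vnorm v.
Proof.
apply/eqP; rewrite -(eqrXn2 (n := 2)) ?mulr_ge0 ?vnorm_ge0//; apply/eqP.
rewrite exprMn !vnorm_sqr real_normK ?num_real// mulr_sumr.
by apply: eq_bigr => i _; rewrite mxE exprMn.
Qed.

Lemma norm_le_vnorm v : `|v| <= vnorm v.
Proof.
apply: norm_row_le => [|i]; first exact: vnorm_ge0.
rewrite -(ler_pXn2r (n := 2)) ?nnegrE ?vnorm_ge0// real_normK ?num_real//.
by rewrite vnorm_sqr sqr_coord_le.
Qed.

Lemma vnorm_le_sum v : vnorm v <= \sum_i `|v 0 i|.
Proof.
have S0 : 0 <= \sum_i `|v 0 i| by exact: sumr_ge0.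
rewrite -(ler_pXn2r (n := 2)) ?nnegrE ?vnorm_ge0// vnorm_sqr expr2 mulr_sumr.
apply: ler_sum => i _; rewrite -real_normK ?num_real// expr2 ler_wpM2r//.
by rewrite (bigD1 i)//= lerDl sumr_ge0.
Qed.

(** Cauchy-Schwarz against the constant vector, from
    [2 * |a| * |b| <= a^2 + b^2]. *)
Lemma sum_norm_sqr_le v : (\sum_i `|v 0 i|) ^+ 2 <= m%:R * \sum_i v 0 i ^+ 2.
Proof.
have -> : (\sum_i `|v 0 i|) ^+ 2 = \sum_i \sum_l `|v 0 i| * `|v 0 l|.
  by rewrite expr2 mulr_suml; apply: eq_bigr => i _; rewrite mulr_sumr.
have ES : \sum_i \sum_l (v 0 i ^+ 2 + v 0 l ^+ 2) =
    2 * (m%:R * \sum_i v 0 i ^+ 2).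
  under eq_bigr do rewrite big_split/= sumr_const card_ord.
  by rewrite big_split/= sumr_const card_ord sumrMnl mulr_natl; ring.
rewrite -(ler_pM2l (ltr0n R 2)) -ES mulr_sumr.
apply: ler_sum => i _; rewrite mulr_sumr; apply: ler_sum => l _.
rewrite -[v 0 i ^+ 2]real_normK ?num_real// -[v 0 l ^+ 2]real_normK ?num_real//.
have := sqr_ge0 (`|v 0 i| - `|v 0 l|); nra.
Qed.

End EuclideanNorm.

(** * Coercivity and strong monotonicity *)

Section Coercivity.
Context (R : realType) (m : nat).
Implicit Types (A E : 'M[R]_m) (u v x y : 'rV[R]_m).

Lemma quadratic_formE A v :
  (v *m A *m v^T) 0 0 = \sum_i v 0 i * \sum_l A i l * v 0 l.
Proof.
rewrite -mulmxA mxE; apply: eq_bigr => i _; rewrite mxE.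
by congr (_ * _); apply: eq_bigr => l _; rewrite mxE.
Qed.

Lemma opnorm_bound A (C : R) v :
  (opnorm A <= C%:E)%E -> vnorm (A *m v^T)^T <= C * vnorm v.
Proof.
move=> AC; have unit_le u : vnorm u <= 1 -> vnorm (A *m u^T)^T <= C.
  move=> u1; rewrite -lee_fin; apply: le_trans AC.
  by apply: ereal_sup_ubound; exists u.
have [v0|v0] := eqVneq (vnorm v) 0.
  have -> : v = 0.
    by apply/eqP; rewrite -normr_eq0 eq_le normr_ge0 andbT -v0 norm_le_vnorm.
  by rewrite trmx0 mulmx0 trmx0 -[0](scale0r 0) vnormZ normr0 !mul0r mulr0.
have v_gt0 : 0 < vnorm v by rewrite lt_neqAle eq_sym v0 vnorm_ge0.
have := unit_le ((vnorm v)^-1 *: v).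
rewrite !linearZ/= !vnormZ normfV (ger0_norm (vnorm_ge0 v)).
rewrite mulVf// => /(_ (lexx _)).
by rewrite ler_pdivrMl// mulrC.
Qed.

(** A lower bound on the eigenvalues without the spectral theorem: with
    [A u = v], positivity of [A] on [v - u / C] gives
    [0 <= v A v - 2 |v|^2 / C + (u . v) / C^2], and [u . v <= C |v|^2] because
    [|u| <= C |v|]. *)
Lemma sym_posdef_coercive A (C : R) v : 0 < C ->
  sym_posdef A -> (opnorm (invmx A) <= C%:E)%E ->
  C^-1 * \sum_i v 0 i ^+ 2 <= (v *m A *m v^T) 0 0.
Proof.
move=> C0 [As Apos] AC.
have Au : A \in unitmx.
  rewrite unitmxE unitfE; apply/negP => /det0P[z z0 zA].
  by have := Apos z z0; rewrite zA mul0mx mxE ltxx.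
have Age0 (z : 'rV[R]_m) : 0 <= (z *m A *m z^T) 0 0.
  have [->|z0] := eqVneq z 0; first by rewrite !mul0mx mxE.
  exact/ltW/Apos.
pose u := (invmx A *m v^T)^T; pose S := \sum_i v 0 i ^+ 2.
have Au_v : A *m u^T = v^T by rewrite trmxK mulKVmx.
have uA_v : u *m A = v by apply: trmx_inj; rewrite trmx_mul As.
have S0 : 0 <= S by rewrite sumr_ge0// => i _; exact: sqr_ge0.
have uS : \sum_i u 0 i ^+ 2 <= C ^+ 2 * S.
  rewrite /S -!vnorm_sqr -exprMn lerXn2r ?nnegrE ?mulr_ge0 ?vnorm_ge0 ?(ltW C0)//.
  exact: opnorm_bound.
have uv : (u *m v^T) 0 0 <= C * S.
  rewrite -(ler_pM2l (mulr_gt0 (ltr0n R 2) C0)).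
  apply: (@le_trans _ _ (\sum_i (u 0 i ^+ 2 + C ^+ 2 * v 0 i ^+ 2))).
    rewrite mxE mulr_sumr; apply: ler_sum => i _; rewrite [v^T _ _]mxE.
    by have := sqr_ge0 (u 0 i - C * v 0 i); lra.
  rewrite big_split/= -mulr_sumr -/S.
  have -> : 2 * C * (C * S) = C ^+ 2 * S + C ^+ 2 * S by ring.
  by rewrite lerD2r.
have vvS : (v *m v^T) 0 0 = S.
  by rewrite mxE; apply: eq_bigr => i _; rewrite mxE expr2.
(* [C^-1] is the coefficient for which the bound [u . v <= C |v|^2] costs exactly
   half of the cross term. *)
have := Age0 (v - C^-1 *: u).
rewrite mulmxBl -scalemxAl uA_v [(v - _)^T]raddfB/= [(_ *: u)^T]linearZ/=.
rewrite mulmxBr !mulmxBl -!scalemxAl -!scalemxAr -[v *m A *m u^T]mulmxA Au_v.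
have -> : (v *m A *m v^T - C^-1 *: (v *m v^T) -
   (C^-1 *: (v *m v^T) - C^-1 *: (C^-1 *: (v *m u^T)))) 0 0 =
  (v *m A *m v^T) 0 0 - 2 * C^-1 * S + C^-1 ^+ 2 * (u *m v^T) 0 0.
  have -> : (u *m v^T) 0 0 = (v *m u^T) 0 0.
    by rewrite -{1}(trmxK u) -trmx_mul mxE.
  rewrite -vvS; move: (v *m A *m v^T) (v *m v^T) (v *m u^T) => X Y Z.
  by rewrite !mxE; ring.
have : C^-1 ^+ 2 * (u *m v^T) 0 0 <= C^-1 ^+ 2 * (C * S).
  by rewrite ler_wpM2l// sqr_ge0.
have -> : C^-1 ^+ 2 * (C * S) = C^-1 * S by field; exact: lt0r_neq0.
rewrite -/S; lra.
Qed.

Lemma coercive_perturb A E (b eta : R) v : 0 <= eta ->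
  b * \sum_i v 0 i ^+ 2 <= (v *m A *m v^T) 0 0 ->
  (forall i l, `|E i l| <= eta) ->
  (b - eta * m%:R) * \sum_i v 0 i ^+ 2 <= (v *m (A + E) *m v^T) 0 0.
Proof.
move=> eta0 Ab Eeta.
rewrite mulmxDr mulmxDl [leRHS]mxE mulrBl lerD//.
rewrite -mulrA lerNl (le_trans (ler_norm _))// normrN quadratic_formE.
apply: le_trans (ler_norm_sum _ _ _) _.
apply: (@le_trans _ _ (eta * (\sum_i `|v 0 i|) ^+ 2)); last first.
  by rewrite ler_wpM2l// sum_norm_sqr_le.
rewrite expr2 mulr_suml mulr_sumr; apply: ler_sum => i _.
rewrite normrM mulrCA ler_wpM2l// (le_trans (ler_norm_sum _ _ _))//.
rewrite mulr_sumr; apply: ler_sum => l _.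
by rewrite normrM ler_wpM2r.
Qed.

(** Along the segment, the derivative of the component of [f] in the direction
    [x - y] is the quadratic form at [x - y], which is bounded below. *)
Lemma strongly_monotone (Omega : set 'rV[R]_m) (f : 'rV[R]_m -> 'rV[R]_m)
    (b : R) x y :
  open Omega -> Ck_on 1 Omega f ->
  (forall z v, Omega z ->
    b * \sum_i v 0 i ^+ 2 <= (v *m partial_mx f z *m v^T) 0 0) ->
  (forall t, 0 <= t <= 1 -> Omega (y + t *: (x - y))) ->
  b * \sum_i (x - y) 0 i ^+ 2 <= \sum_i (x - y) 0 i * (f x - f y) 0 i.
Proof.
move=> Uo fC fb Uxy; set v := x - y.
pose phi (t : R) := \sum_i v 0 i * f (y + t *: v) 0 i.
have dphi (t : R) : t \in `[0, 1]%R ->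
    is_derive t (1 : R) phi ((v *m partial_mx f (y + t *: v) *m v^T) 0 0).
  rewrite in_itv/= => /Uxy Uz.
  have coord l : is_derive t (1 : R) (fun s => (y + s *: v) 0 l) (v 0 l).
    rewrite (_ : (fun s => _) = cst (y 0 l) + v 0 l *: (id : R -> R)).
      by apply: is_derive_eq; rewrite add0r [_ *: _]mulr1.
    by apply/funext => s; rewrite !mxE mulrC.
  rewrite quadratic_formE.
  have dterm i : is_derive t (1 : R) (fun s => v 0 i * f (y + s *: v) 0 i)
      (v 0 i * \sum_l partial_mx f (y + t *: v) i l * v 0 l).
    apply: is_deriveZ.
    have -> : \sum_l partial_mx f (y + t *: v) i l * v 0 l =
        \sum_l dpartial [:: l] f (y + t *: v) 0 i * v 0 l.
      by apply: eq_bigr => l _; rewrite [partial_mx _ _ _ _]mxE.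
    apply: (@is_derive_curve R m (fun z => f z 0 i)
      (fun l z => dpartial [:: l] f z 0 i) (fun s => y + s *: v) t (fun l => v 0 l)).
      exact: (is_derive_partial Uo).
    by move=> l; exact: (continuous_partial fC).
  rewrite (_ : phi = \sum_i (fun s => v 0 i * f (y + s *: v) 0 i)).
    exact: is_derive_sum.
  by apply/funext => s; rewrite fct_sumE.
have phic : {within `[0, 1], continuous phi}.
  by apply: derivable_within_continuous => t t01; have [] := dphi t t01.
have [c] := MVT_segment ler01 (fun t t01 => dphi t (subset_itv_oo_cc t01)) phic.
rewrite in_itv/= => c01; rewrite subr0 mulr1.
have yv : y + v = x by rewrite /v addrC subrK.
rewrite /phi scale1r scale0r addr0 yv => E.
apply: le_trans (fb _ v (Uxy c c01)) _.
rewrite -E -sumrB le_eqVlt; apply/orP; left; apply/eqP.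
by apply: eq_bigr => i _; rewrite -mulrBr !mxE.
Qed.

End Coercivity.

(** * The weighted estimating equation *)

Section WeightedEquation.
Context (R : realType) (D : nat) (g : nat -> 'rV[R]_D -> 'rV[R]_D).

(** The scale on which weights act on [G]: the average of the perturbations. *)
Definition wdist N (w w' : 'rV[R]_N) : R := N%:R^-1 * \sum_n `|w 0 n - w' 0 n|.

Lemma wdist_ge0 N (w w' : 'rV[R]_N) : 0 <= wdist w w'.
Proof. by rewrite mulr_ge0 ?invr_ge0 ?sumr_ge0. Qed.

Lemma wdistxx N (w : 'rV[R]_N) : wdist w w = 0.
Proof.
rewrite /wdist big1 ?mulr0// => n _.
by rewrite subrr normr0.
Qed.

Lemma wdistC N (w w' : 'rV[R]_N) : wdist w w' = wdist w' w.
Proof. by congr (_ * _); apply: eq_bigr => n _; rewrite distrC. Qed.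

Lemma wdist_le_norm N (w w' : 'rV[R]_N) : wdist w w' <= `|w - w'|.
Proof.
have [N0|N0] := posnP N.
  by rewrite /wdist (_ : N%:R^-1 = 0) ?mul0r// N0 invr0.
rewrite /wdist ler_pdivrMl ?ltr0n//.
apply: (@le_trans _ _ (\sum_(n < N) `|w - w'|)).
  by apply: ler_sum => n _; have := norm_coord (w - w') n; rewrite !mxE.
by rewrite sumr_const card_ord mulr_natl.
Qed.

Lemma G_subE N th (w w' : 'rV[R]_N) : G g th w - G g th w' =
  N%:R^-1 *: \sum_(n < N) (w 0 n - w' 0 n) *: g n.+1 th.
Proof.
rewrite /G -scalerBr opprD addrACA subrr add0r -sumrB.
by congr (_ *: _); apply: eq_bigr => n _; rewrite scalerBl.
Qed.

Lemma wsum_le N (w w' : 'rV[R]_N) (x : 'I_N -> R) (B : R) :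
  (forall n, `|x n| <= B) ->
  `|N%:R^-1 * \sum_n (w 0 n - w' 0 n) * x n| <= wdist w w' * B.
Proof.
move=> xB; rewrite normrM ger0_norm ?invr_ge0// -mulrA ler_wpM2l ?invr_ge0//.
rewrite mulr_suml (le_trans (ler_norm_sum _ _ _))//.
by apply: ler_sum => n _; rewrite normrM ler_wpM2l.
Qed.

Context (Omega : set 'rV[R]_D) (k : nat).
Hypothesis Omega_open : open Omega.
Hypothesis gC : forall n, Ck_on k Omega (g n).

(** [unlift ord0] separates the unweighted term [g 0] from the others. *)
Lemma G_lincomb N (w : 'rV[R]_N) th : G g th w =
  \sum_(n < N.+1) (N%:R^-1 * oapp (w 0) 1 (unlift ord0 n)) *: g n th.
Proof.
rewrite big_ord_recl unlift_none/= mulr1 /G scalerDr; congr (_ + _).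
rewrite scaler_sumr; apply: eq_bigr => n _.
by rewrite liftK/= scalerA.
Qed.

Lemma Ck_on_G N (w : 'rV[R]_N) : Ck_on k Omega (fun th => G g th w).
Proof.
have -> : (fun th => G g th w) = fun th =>
    \sum_(n < N.+1) (N%:R^-1 * oapp (w 0) 1 (unlift ord0 n)) *: g n th.
  by apply/funext => th; exact: G_lincomb.
exact: Ck_on_lincomb.
Qed.

Lemma dpartial_G N (w : 'rV[R]_N) s th : (size s <= k)%N -> Omega th ->
  dpartial s (fun th => G g th w) th = G (fun n => dpartial s (g n)) th w.
Proof.
move=> sk Uth; have -> : (fun th => G g th w) = fun th =>
    \sum_(n < N.+1) (N%:R^-1 * oapp (w 0) 1 (unlift ord0 n)) *: g n th.
  by apply/funext => t; exact: G_lincomb.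
rewrite (dpartial_lincomb Omega_open _ (fun n : 'I_N.+1 => gC n) sk Uth).
rewrite big_ord_recl unlift_none/= mulr1 /G scalerDr; congr (_ + _).
rewrite scaler_sumr; apply: eq_bigr => n _.
by rewrite liftK/= scalerA.
Qed.

End WeightedEquation.

Section WeightVectors.
Context (R : realType) (N : nat).
Implicit Types w : 'rV[R]_N.

Lemma loo_ones (n : 'I_N) : loo R n = ones R N - delta_mx 0 n.
Proof.
apply/rowP => i; rewrite !mxE eqxx/=.
by case: eqP => _; rewrite ?subrr ?subr0.
Qed.

Lemma Omega_w_near_ones (e : R) w w' :
  vnorm (w' - ones R N) < e -> Omega_w e w w'.
Proof.
by move=> we; exists 0; rewrite lexx ler01 subr0 scale1r scale0r addr0.
Qed.

Lemma vnorm_delta (n : 'I_N) : vnorm (delta_mx 0 n : 'rV[R]_N) = 1.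
Proof.
rewrite /vnorm /norm2 (bigD1 n)//= !mxE !eqxx/= expr1n big1 ?addr0 ?sqrtr1//.
by move=> i /negbTE ni; rewrite mxE ni andbF expr0n.
Qed.

Lemma Omega_w_line (e u : R) (n : 'I_N) : 0 < e -> - e < u < 1 + e ->
  Omega_w e (loo R n) (ones R N - u *: delta_mx 0 n).
Proof.
move=> e0 /andP[ue eu]; exists (Num.max 0 (Num.min u 1)); split.
  by rewrite le_max lexx/= ge_max ler01 ge_min lexx orbT.
set t := Num.max _ _.
have -> : ones R N - u *: delta_mx 0 n -
    ((1 - t) *: ones R N + t *: loo R n) = (t - u) *: delta_mx 0 n.
  rewrite loo_ones; move: (ones R N) (delta_mx 0 n) => x y.
  by apply/rowP => i; rewrite !mxE; ring.
rewrite vnormZ vnorm_delta mulr1 /t.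
have [u1|u1] := leP u 1.
  have [u0|u0] := leP 0 u; first by rewrite subrr normr0.
  by rewrite sub0r normrN ltr0_norm//; lra.
rewrite (max_r ler01) ler0_norm; lra.
Qed.

Lemma hull_segment (D : nat) (A : set 'rV[R]_D) x y (t : R) : 0 <= t <= 1 ->
  A x -> A y -> convex_hull A (y + t *: (x - y)).
Proof.
move=> /andP[t0 t1] Ax Ay B [Bconv AB].
have := Bconv x y (Itv01 t0 t1); rewrite !inE => /(_ (AB _ Ax) (AB _ Ay)).
rewrite /conv/= /unstable.onem; congr (B _); apply/rowP => i; rewrite !mxE; ring.
Qed.

End WeightVectors.

(** * Coercivity for weights close to one *)

Section Bounds.
Context (R : realType) (D K : nat) (Omega : set 'rV[R]_D).
Context (g : nat -> 'rV[R]_D -> 'rV[R]_D) (Cop : R).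
Hypothesis Omega_open : open Omega.
Hypothesis g_Ck : forall n, Ck_on K.+1 Omega (g n).
Hypothesis gamma_fin : forall k, (k <= K.+1)%N ->
  (ereal_sup [set gamma k Omega (g n) | n in [set n | (1 <= n)%N]] < +oo)%E.

(** The supremum of the constants [gamma] as a real number that bounds all
    partial derivatives of a given order. *)
Lemma partial_bound k : (k <= K.+1)%N -> exists2 B : R, 0 <= B &
  forall (s : seq 'I_D) n x i, size s = k -> Omega x ->
    `|dpartial s (g n.+1) x 0 i| <= B.
Proof.
move=> kK; have := gamma_fin kK; set e := ereal_sup _ => e_fin.
exists `|fine e|; first exact: normr_ge0.
move=> s n x i sk Ux; apply: le_trans (ler_norm _).
have le_e : ((norm_inf (darray (k := k) (g n.+1) x))%:E <= e)%E.
  apply: (@le_trans _ _ (gamma k Omega (g n.+1))).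
    by apply: ereal_sup_ubound; exists x.
  by apply: ereal_sup_ubound; exists n.+1.
have st : size s == k by exact/eqP.
apply: (@le_trans _ _ (norm_inf (darray (k := k) (g n.+1) x))).
  exact: (@le_bigmax _ _ _ 0 (fun si => `|darray (g n.+1) x si|) (Tuple st, i)).
by move: e e_fin le_e => [r| |].
Qed.

Hypothesis H_posdef : forall N theta, (0 < N)%N -> Omega theta ->
  sym_posdef (H g theta (ones R N)) /\
  (opnorm (invmx (H g theta (ones R N))) <= Cop%:E)%E.

Let H_partial_mx N theta (w : 'rV[R]_N) :
  H g theta w = partial_mx (fun th => G g th w) theta.
Proof. by apply/matrixP => i l; rewrite !mxE. Qed.

(** Moving the weights by at most [kappa] changes the quadratic form by at most
    [kappa * B * D <= 1 / (2 C)] times [|v|^2], which is half of the coercivity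
    constant [1 / C] at the weights one.
    The first bound is used for the monotonicity of [G] at arbitrary weights,
    the second for the system that the leave-one-out path solves. *)
Lemma coercive_near_ones : exists b kappa : R, [/\ 0 < b, 0 < kappa,
  forall N (w : 'rV[R]_N) theta (v : 'rV[R]_D), (0 < N)%N -> Omega theta ->
    wdist w (ones R N) <= kappa ->
    b * \sum_i v 0 i ^+ 2 <=
      (v *m partial_mx (fun th => G g th w) theta *m v^T) 0 0 &
  forall N n theta (v : 'rV[R]_D) (s : R), (0 < N)%N -> Omega theta ->
    `|s| <= kappa ->
    b * \sum_i v 0 i ^+ 2 <=
      (v *m (partial_mx (fun th => G g th (ones R N)) theta -
             s *: partial_mx (g n.+1) theta) *m v^T) 0 0].
Proof.
have [//|B B0 gB] := @partial_bound 1.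
(* [Cop] need not be positive, for instance when [D = 0]. *)
pose C := Num.max 1 Cop; have C0 : 0 < C by rewrite lt_max ltr01.
pose kappa := C^-1 / 2 / (B * D%:R + 1).
have BD0 : 0 < B * D%:R + 1 by rewrite ltr_wpDl// mulr_ge0.
have k0 : 0 < kappa by rewrite !divr_gt0 ?invr_gt0.
have kBD : kappa * B * D%:R <= C^-1 / 2.
  rewrite -mulrA /kappa mulrAC ler_pdivrMr// ler_wpM2l ?lerDl//.
  by rewrite divr_ge0 ?invr_ge0// ltW.
have at_ones N theta (v : 'rV[R]_D) : (0 < N)%N -> Omega theta ->
    C^-1 * \sum_i v 0 i ^+ 2 <=
      (v *m partial_mx (fun th => G g th (ones R N)) theta *m v^T) 0 0.
  move=> N0 Ut; have [Hpos Hinv] := H_posdef N0 Ut.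
  rewrite -H_partial_mx; apply: sym_posdef_coercive => //.
  by apply: le_trans Hinv _; rewrite lee_fin le_max lexx orbT.
have perturb N theta (v : 'rV[R]_D) (E : 'M[R]_D) : (0 < N)%N -> Omega theta ->
    (forall i l, `|E i l| <= kappa * B) ->
    C^-1 / 2 * \sum_i v 0 i ^+ 2 <=
      (v *m (partial_mx (fun th => G g th (ones R N)) theta + E) *m v^T) 0 0.
  move=> N0 Ut EB; have kB0 : 0 <= kappa * B by rewrite mulr_ge0// ltW.
  apply: le_trans (coercive_perturb kB0 (at_ones N theta v N0 Ut) EB).
  rewrite ler_wpM2r ?sumr_ge0// => [i _|]; first exact: sqr_ge0.
  lra.
exists (C^-1 / 2), kappa; split=> //; first by rewrite divr_gt0 ?invr_gt0.
- move=> N w theta v N0 Ut wk.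
  have -> : partial_mx (fun th => G g th w) theta =
      partial_mx (fun th => G g th (ones R N)) theta +
      \matrix_(i, l) (N%:R^-1 * \sum_(n < N) (w 0 n - ones R N 0 n) *
        dpartial [:: l] (g n.+1) theta 0 i).
    apply/matrixP => i l; rewrite !mxE -!/(dpartial [:: l] _ _).
    rewrite !(dpartial_G Omega_open g_Ck)//.
    rewrite -[LHS](subrK (G (fun n => dpartial [:: l] (g n)) theta (ones R N) 0 i)).
    rewrite [RHS]addrC; congr (_ + _).
    have := congr1 (fun v : 'rV_D => v 0 i)
      (G_subE (fun n => dpartial [:: l] (g n)) theta w (ones R N)).
    rewrite mxE [(- G _ _ _) _ _]mxE => ->; rewrite mxE summxE.
    by congr (_ * _); apply: eq_bigr => n _; rewrite [LHS]mxE.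
  apply: perturb => // i l; rewrite mxE.
  apply: le_trans (wsum_le _ _ (fun n => gB [:: l] n theta i erefl Ut)) _.
  by rewrite ler_wpM2r.
- move=> N n theta v s N0 Ut sk; apply: perturb => // i l.
  rewrite !mxE normrN normrM ler_pM//.
  exact: (gB [:: l]).
Qed.

End Bounds.

(** * The solution as a function of the weights *)

Section Estimator.
Context (R : realType) (D K : nat) (Omega : set 'rV[R]_D).
Context (g : nat -> 'rV[R]_D -> 'rV[R]_D) (b kappa B0 : R).
Hypothesis Omega_open : open Omega.
Hypothesis g_Ck : forall n, Ck_on K.+1 Omega (g n).
Hypothesis b_gt0 : 0 < b.
Hypothesis kappa_gt0 : 0 < kappa.
Hypothesis B0_ge0 : 0 <= B0.
Hypothesis g_bounded :
  forall n theta i, Omega theta -> `|g n.+1 theta 0 i| <= B0.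
Context (N : nat).
Hypothesis coercive : forall (w : 'rV[R]_N) theta (v : 'rV[R]_D), Omega theta ->
  wdist w (ones R N) <= kappa ->
  b * \sum_i v 0 i ^+ 2 <=
    (v *m partial_mx (fun th => G g th w) theta *m v^T) 0 0.

(** Strong monotonicity bounds [x - y] by the residual of [y] in the equation
    with weights [w], which is a difference of [G] at two weight vectors. *)
Lemma solution_lipschitz (w w' : 'rV[R]_N) x y :
  wdist w (ones R N) <= kappa ->
  (forall t, 0 <= t <= 1 -> Omega (y + t *: (x - y))) ->
  G g x w = 0 -> G g y w' = 0 ->
  `|x - y| <= B0 * D%:R / b * wdist w w'.
Proof.
move=> wk Uxy Gx Gy; set v := x - y.
have Uy : Omega y by have := Uxy 0; rewrite lexx ler01 scale0r addr0; exact.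
have C1 : Ck_on 1 Omega (fun th => G g th w).
  by apply: Ck_on_le (Ck_on_G Omega_open g_Ck w).
have := strongly_monotone Omega_open C1
  (fun z u Uz => coercive u Uz wk) Uxy.
rewrite Gx -/v => mono.
have [v0|v0] := eqVneq `|v| 0.
  by rewrite v0 mulr_ge0 ?wdist_ge0// divr_ge0 ?mulr_ge0// ltW.
have v_gt0 : 0 < `|v| by rewrite lt_neqAle eq_sym v0 normr_ge0.
rewrite mulrAC ler_pdivlMr// mulrC -(ler_pM2r v_gt0).
apply: (@le_trans _ _ (b * \sum_i v 0 i ^+ 2)).
  rewrite -mulrA ler_pM2l// -expr2 -vnorm_sqr.
  by rewrite lerXn2r ?nnegrE ?vnorm_ge0// norm_le_vnorm.
apply: le_trans mono _.
have -> : 0 - G g y w = G g y w' - G g y w by rewrite Gy.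
rewrite G_subE; apply: le_trans (ler_norm _) (le_trans (ler_norm_sum _ _ _) _).
apply: (@le_trans _ _ (\sum_(i < D) `|v| * (wdist w' w * B0))).
  apply: ler_sum => i _; rewrite normrM ler_pM ?norm_coord//.
  rewrite mxE summxE.
  under eq_bigr do rewrite mxE.
  by apply: wsum_le => n; exact: g_bounded.
rewrite sumr_const card_ord -mulr_natl wdistC le_eqVlt.
by apply/orP; left; apply/eqP; ring.
Qed.

Context (hat : 'rV[R]_N -> 'rV[R]_D) (e : R) (w0 : 'rV[R]_N).
Hypothesis e_gt0 : 0 < e.
Hypothesis hat_solves : forall w, Omega_w e w0 w -> G g (hat w) w = 0.
Hypothesis hull_Omega :
  contains_neighborhood Omega (convex_hull (hat @` Omega_w e w0)).

Lemma hat_segment w w' (t : R) : Omega_w e w0 w -> Omega_w e w0 w' ->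
  0 <= t <= 1 -> Omega (hat w' + t *: (hat w - hat w')).
Proof.
move=> Ow Ow' t01; have [r r0 hullr] := hull_Omega.
apply: (hullr _ (hat w' + t *: (hat w - hat w'))).
  by apply: hull_segment.
by rewrite subrr -[0](scale0r 0) vnormZ normr0 mul0r.
Qed.

Lemma hat_Omega w : Omega_w e w0 w -> Omega (hat w).
Proof.
move=> Ow; have := @hat_segment w w 0 Ow Ow.
by rewrite lexx ler01 scale0r addr0; exact.
Qed.

Lemma hat_lipschitz w w' : Omega_w e w0 w -> Omega_w e w0 w' ->
  wdist w (ones R N) <= kappa ->
  `|hat w - hat w'| <= B0 * D%:R / b * wdist w w'.
Proof.
move=> Ow Ow' wk; apply: solution_lipschitz => //; try exact: hat_solves.
by move=> t; exact: hat_segment.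
Qed.

Let one := ones R N.

Lemma near_ones (r : R) : 0 < r -> \forall w \near one, `|w - one| < r.
Proof.
move=> r0; apply/nbhs_ballP; exists r => // w.
by rewrite -ball_normE /= distrC.
Qed.

Lemma vnorm_le_norm m (v : 'rV[R]_m) : vnorm v <= m%:R * `|v|.
Proof.
apply: le_trans (vnorm_le_sum v) _.
apply: (@le_trans _ _ (\sum_(i < m) `|v|)).
  by apply: ler_sum => i _; exact: norm_coord.
by rewrite sumr_const card_ord mulr_natl.
Qed.

Lemma near_ones_Omega_w : \forall w \near one, Omega_w e w0 w.
Proof.
have r0 : 0 < e / (N%:R + 1) by rewrite divr_gt0// ltr_wpDl.
apply: filterS (near_ones r0) => w wr; apply: Omega_w_near_ones.
apply: le_lt_trans (vnorm_le_norm _) _.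
have : (N%:R + 1) * `|w - one| < e by rewrite mulrC -ltr_pdivlMr// ltr_wpDl.
by apply: le_lt_trans; rewrite ler_wpM2r// lerDl.
Qed.

Lemma wdist_near_ones : \forall w \near one, wdist w one <= kappa.
Proof.
apply: filterS (near_ones kappa_gt0) => w wk.
exact: le_trans (wdist_le_norm _ _) (ltW wk).
Qed.

Lemma Omega_w_ones : Omega_w e w0 one.
Proof. exact: nbhs_singleton near_ones_Omega_w. Qed.

Lemma hat_continuous_ones : {for one, continuous hat}.
Proof.
apply/(@cvgrPdist_lt _ _ _ _ (nbhs_filter one)) => r r0.
pose L := B0 * D%:R / b.
have L0 : 0 <= L by rewrite divr_ge0 ?mulr_ge0// ltW.
have s0 : 0 < r / (L + 1) by rewrite divr_gt0// ltr_wpDl.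
have : \forall w \near one, Omega_w e w0 w /\ `|w - one| < r / (L + 1).
  by apply: filterI; [exact: near_ones_Omega_w|exact: near_ones].
apply: filterS => w [Ow ws].
apply: le_lt_trans (hat_lipschitz Omega_w_ones Ow _) _.
  by rewrite wdistxx ltW.
rewrite wdistC -/L; apply: (@le_lt_trans _ _ (L * `|w - one|)).
  by rewrite ler_wpM2l// wdist_le_norm.
have : (L + 1) * `|w - one| < r by rewrite mulrC -ltr_pdivlMr// ltr_wpDl.
by apply: le_lt_trans; rewrite ler_wpM2r// lerDl.
Qed.

(** A solution near the full-data one can be joined to the selected solution for
    the same weights by a segment inside a ball contained in [Omega], so
    [solution_lipschitz] with equal weights identifies the two. *)
Lemma hat_solution_branch : solution_branch g (hat one) one hat.
Proof.
split=> //; first exact: hat_continuous_ones.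
have : nbhs (hat one) Omega.
  exact/(open_nbhs_nbhs)/(conj Omega_open)/hat_Omega/Omega_w_ones.
move=> /nbhs_ballP[r /= r0 ballr].
have near_hat : \forall w \near one, `|hat one - hat w| < r.
  exact: (@cvgr_dist_lt _ _ _ _ (nbhs_filter one) _ _ hat_continuous_ones _ r0).
have near_w : \forall w \near one,
    [/\ Omega_w e w0 w, wdist w one <= kappa & `|hat one - hat w| < r].
  apply: filterS (filterI near_ones_Omega_w (filterI wdist_near_ones near_hat)).
  by move=> w [? []].
exists (ball (hat one) r, [set w | [/\ Omega_w e w0 w, wdist w one <= kappa &
    `|hat one - hat w| < r]]).
  by split=> //=; exact: nbhsx_ballx.
move=> [x w] /= [xr [Ow wk wr]]; split=> [Gx|->]; last exact: hat_solves.
apply/eqP; rewrite -subr_eq0 -normr_eq0 eq_le normr_ge0 andbT.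
apply: le_trans (solution_lipschitz wk _ Gx (hat_solves Ow)) _; last first.
  by rewrite wdistxx mulr0.
move=> t /andP[t0 t1]; apply: ballr; rewrite -ball_normE /=.
rewrite -ball_normE /= in xr.
have -> : hat one - (hat w + t *: (x - hat w)) =
    (1 - t) *: (hat one - hat w) + t *: (hat one - x).
  by apply/rowP => i; rewrite !mxE; ring.
apply: le_lt_trans (ler_normD _ _) _; rewrite !normrZ.
rewrite (ger0_norm t0) ger0_norm ?subr_ge0//.
have -> : r = (1 - t) * r + t * r by ring.
have [->|t0'] := eqVneq t 0; first by rewrite !mul0r !addr0 subr0 !mul1r.
apply: ler_ltD; first by rewrite ler_wpM2l ?subr_ge0// ltW.
by rewrite ltr_pM2l// lt_neqAle eq_sym t0' t0.
Qed.

(** The chosen branch and the selected solution are both continuous and solve the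
    equation near the weights one, where the branch is the only solution. *)
Lemma branch_near_ones :
  \forall w \near one, branch g (hat one) one w = hat w.
Proof.
have [b1 bc bG] : solution_branch g (hat one) one (branch g (hat one) one).
  by apply: xgetPex; exists hat; exact: hat_solution_branch.
have hw : (hat w, w) @[w --> one] --> (hat one, one).
  exact: (@cvg_pair _ _ _ _ _ _ (nbhs_filter one) (nbhs_filter (hat one))
    (nbhs_filter one) hat id hat_continuous_ones cvg_id).
have : \forall w \near one, Omega_w e w0 w /\
    (G g (hat w) w = 0 <-> hat w = branch g (hat one) one w).
  by apply: filterI; [exact: near_ones_Omega_w|exact: (hw _ bG)].
by apply: filterS => w [Ow [/(_ (hat_solves Ow))]].
Qed.

End Estimator.

(** * Derivatives along a coordinate axis of weight space *)

Section LineDerivatives.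
Context (R : realType).

Lemma unif_diff_derivable (J : Type) (I : J -> set R) (k l : nat)
    (f f' : J -> R -> R) : (forall j, open (I j)) ->
  (forall j s, I j s -> is_derive s (1 : R) (f j) (f' j s)) ->
  unif_diff I k f' -> (l <= k)%N ->
  forall j s, I j s -> derivable (derive1n l (f j)) s 1.
Proof.
move=> Io; elim: l k f f' => [|l IHl] k f f' df f'k lk j s Is.
  by have [] := df j s Is.
case: k lk f'k => // k lk [_ [f'' [df' f''k]]].
have := IHl k f' f'' df' f''k lk j s Is.
apply: near_eq_derivable; have : nbhs s (I j) by exact: open_nbhs_nbhs.
apply: filterS => t It; rewrite derive1Sn.
apply: (derive1n_eq_open _ (Io j)) => // x Ix.
by rewrite derive1E; have [_ ->] := df j x Ix.
Qed.

(** Iterated partial derivatives along one axis only see the restriction to a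
    line.  The factor [a] rescales the parameter and comes out as a power. *)
Lemma dpartial_line (N D : nat) (f : 'rV[R]_N -> 'rV[R]_D) (n : 'I_N)
    (x0 : 'rV[R]_N) (a : R) (U : set R) (u : R -> 'rV[R]_D) (k : nat) :
  a != 0 -> open U ->
  (forall s, U s -> f (x0 + (a * s) *: delta_mx 0 n) = u s) ->
  (forall l s i, (l < k)%N -> U s ->
     derivable (derive1n l (fun t => u t 0 i)) s 1) ->
  forall s i, U s -> dpartial (nseq k n) f (x0 + (a * s) *: delta_mx 0 n) 0 i =
    a^-1 ^+ k * derive1n k (fun t => u t 0 i) s.
Proof.
move=> a0 Uo fu; elim: k => [|k IHk] du s i Us; first by rewrite mul1r /= fu.
have {}IHk := IHk (fun l t i' lk => du l t i' (ltnW lk)).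
pose B := dpartial (nseq k n) f; pose e : 'rV[R]_N := delta_mx 0 n.
have dB i' : is_derive (x0 + (a * s) *: e) e (fun z => B z 0 i')
    (a^-1 ^+ k.+1 * derive1n k.+1 (fun t => u t 0 i') s).
  apply/is_derive_lineP.
  pose v := derive1n k (fun t => u t 0 i').
  have asK : a^-1 * (a * s) = s by rewrite mulKf.
  have dv : is_derive (a * s) (1 : R) (a^-1 ^+ k *: (v \o ( *%R a^-1)))
      (a^-1 ^+ k.+1 * derive1n k.+1 (fun t => u t 0 i') s).
    have dvs : is_derive (a^-1 * (a * s)) (1 : R) v
        (derive1n k.+1 (fun t => u t 0 i') s).
      rewrite asK derive1nS derive1E; apply: derivableP; exact: du.
    have da : is_derive (a * s) (1 : R) ( *%R a^-1) a^-1.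
      by apply: is_derive_eq; exact: mulr1.
    have dcomp := is_derive1_comp dvs da.
    apply: is_derive_eq; rewrite exprSr -mulrA; congr (_ * _); exact: mulrC.
  apply: near_eq_is_derive dv.
  have Ut : \forall t \near a * s, U (a^-1 * t).
    have : {for a * s, continuous ( *%R a^-1)} by exact: mulrl_continuous.
    by apply; rewrite /= asK; exact: open_nbhs_nbhs.
  by apply: filterS Ut => t Ut; have := IHk _ i' Ut; rewrite mulVKf// => ->.
have derB : derivable B (x0 + (a * s) *: e) e.
  by apply/derivable_mxP => i1 i2; rewrite ord1; have [] := dB i2.
rewrite /= -[LHS]/(('D_e B (x0 + (a * s) *: e)) 0 i) (derive_mx derB) mxE.
exact: (derive_val (is_derive := dB i)).
Qed.

(** The direction is [- e_n], so that all other mixed partial derivatives are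
    multiplied by zero. *)
Lemma dirder_loo (N D k : nat) (b : 'rV[R]_N -> 'rV[R]_D) (n : 'I_N) :
  dirder k b (loo R n) = (-1) ^+ k *: dpartial (nseq k n) b (ones R N).
Proof.
have dE m : (loo R n - ones R N) 0 m = - (m == n)%:R.
  by rewrite !mxE; case: eqP => _; rewrite ?subrr ?sub0r ?oppr0.
rewrite /dirder (bigD1 (nseq_tuple k n))//= [X in _ + X]big1 ?addr0 => [|t tn].
  by congr (_ *: _); rewrite big_nseq iter_mulr_1 dE eqxx.
have /allPn[m mt mn] : ~~ all (pred1 n) t.
  apply: contra tn => /all_pred1P tn; apply/eqP/val_inj => /=.
  by rewrite tn size_tuple.
rewrite (_ : \prod_(m <- t) _ = 0) ?scale0r//; apply/eqP.
rewrite prodf_seq_eq0; apply/hasP; exists m => //=.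
by rewrite dE -[m == n]/(pred1 n m) (negbTE mn) oppr0.
Qed.

End LineDerivatives.

(** * The leave-one-out path *)

Lemma norm_entry_le_norm2 (R : realType) (I : finType) (a : I -> R) i : `|a i| <= norm2 a.
Proof.
rewrite -sqrtr_sqr ler_wsqrtr// (bigD1 i)//= lerDl.
by apply: sumr_ge0 => l _; exact: sqr_ge0.
Qed.

Section LeaveOneOut.
Context (R : realType) (D K : nat) (Omega : set 'rV[R]_D).
Context (g : nat -> 'rV[R]_D -> 'rV[R]_D).
Context (hat : forall N : nat, 'rV[R]_N -> 'rV[R]_D) (eps : nat -> R).
Context (Cop : R) (M : nat -> R).
Hypothesis Omega_open : open Omega.
Hypothesis eps_gt0 : forall N, 0 < eps N.
Hypothesis gamma_fin : forall k, (k <= K.+1)%N ->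
  (ereal_sup [set gamma k Omega (g n) | n in [set n | (1 <= n)%N]] < +oo)%E.
Hypothesis hat_solves : forall N (n : 'I_N) w,
  Omega_w (eps N) (loo R n) w -> G g (hat w) w = 0.
Hypothesis hull_Omega : forall N (n : 'I_N), contains_neighborhood Omega
  (convex_hull (@hat N @` Omega_w (eps N) (loo R n))).
Hypothesis g_Ck : forall n, Ck_on K.+1 Omega (g n).
Hypothesis H_posdef : forall N theta, (0 < N)%N -> Omega theta ->
  sym_posdef (H g theta (ones R N)) /\
  (opnorm (invmx (H g theta (ones R N))) <= Cop%:E)%E.
Hypothesis G_bounded : forall N k theta, (0 < N)%N -> (1 <= k <= K.+1)%N ->
  Omega theta ->
  norm2 (darray (k := k) (fun th => G g th (ones R N)) theta) <= M k.

(** The parameter is rescaled by [N] to run over [0, 1/N], which removes [N] from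
    the equation solved by the path. *)
Definition loo_path N (n : 'I_N) (s : R) : 'rV[R]_D :=
  hat (ones R N + (- N%:R * s) *: delta_mx 0 n).

(** An open interval around [0, 1/N] (for large [N]) on which the weights stay in
    the neighborhood where solutions are given and the system is coercive. *)
Definition loo_window (kappa : R) N : set R :=
  `](- Num.min kappa (eps N / N%:R)),
    (Num.min kappa (N%:R^-1 + eps N / N%:R))[%classic.

Lemma loo_window_open kappa N : open (loo_window kappa N).
Proof. exact: interval_open. Qed.

Lemma loo_window_bounded kappa N s : loo_window kappa N s -> `|s| <= kappa.
Proof.
rewrite /loo_window /= in_itv/= => /andP[s1 s2]; rewrite ler_norml.
rewrite (le_trans _ (ltW s1)) ?lerN2 ?ge_min ?lexx//.
by rewrite (le_trans (ltW s2))// ge_min lexx.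
Qed.

Lemma loo_window_Omega_w kappa N (n : 'I_N) s : loo_window kappa N s ->
  Omega_w (eps N) (loo R n) (ones R N + (- N%:R * s) *: delta_mx 0 n).
Proof.
have N0 : 0 < N%:R :> R by rewrite ltr0n; case: n => m; exact: leq_trans.
rewrite /loo_window /= in_itv/= => /andP[s1 s2]; rewrite mulNr scaleNr.
apply: Omega_w_line => //.
have : - (eps N / N%:R) < s.
  by apply: le_lt_trans s1; rewrite lerN2 ge_min lexx orbT.
have : s < N%:R^-1 + eps N / N%:R.
  by apply: lt_le_trans s2 _; rewrite ge_min lexx orbT.
rewrite -mulNr ltr_pdivrMr// -{1}[N%:R^-1]mul1r -mulrDl ltr_pdivlMr// => s3 s4.
by rewrite mulrC s3 s4.
Qed.

Lemma loo_window_sub kappa N s : (0 < N)%N -> 0 < kappa -> N%:R^-1 < kappa ->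
  0 <= s <= N%:R^-1 -> loo_window kappa N s.
Proof.
move=> N0 k0 Nk /andP[s0 sN]; have eN : 0 < eps N / N%:R.
  by rewrite divr_gt0// ltr0n.
rewrite /loo_window /= in_itv/=; apply/andP; split.
  by apply: lt_le_trans s0; rewrite oppr_lt0 lt_min k0.
by rewrite lt_min (le_lt_trans sN)//= (le_lt_trans sN)// ltrDl.
Qed.

Lemma wdist_line N (n : 'I_N) (s s' : R) : (0 < N)%N ->
  wdist (ones R N + (- N%:R * s) *: delta_mx 0 n)
        (ones R N + (- N%:R * s') *: delta_mx 0 n) = `|s - s'|.
Proof.
move=> N0; rewrite /wdist (bigD1 n)//= big1 => [|i /negbTE ni]; last first.
  by rewrite !mxE ni andbF !mulr0 subrr normr0.
rewrite !mxE !eqxx/= addr0 opprD addrACA subrr add0r !mulr1 -mulrBr normrM.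
by rewrite normrN normr_nat mulKf// pnatr_eq0 -lt0n.
Qed.

(** The pairs [(N, n)] index one family of paths, to which the implicit function
    theorem and Taylor's formula are applied with constants uniform in both. *)
Lemma loo_error : exists C N0, forall N (n : 'I_N), (N0 <= N)%N ->
  vnorm (theta_IJ K g (hat (ones R N)) (loo R n) - hat (loo R n))
    <= C * N%:R ^- K.+1.
Proof.
have [b [kappa [b0 k0 coercive coercive']]] :=
  coercive_near_ones Omega_open g_Ck gamma_fin H_posdef.
have [//|B B0 gB] := partial_bound gamma_fin (k := 0).
have gB0 n theta i : Omega theta -> `|g n.+1 theta 0 i| <= B.
  exact: (gB [::]).
pose J := {N : nat & 'I_N}.
pose I (j : J) := loo_window kappa (tag j).
pose c (j : J) := loo_path (tagged j).
pose F (j : J) th := G g th (ones R (tag j)).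
pose gj (j : J) := g (tagged j).+1.
have J_gt0 (j : J) : (0 < tag j)%N by case: j => N [m /=]; exact: leq_trans.
have Io j : open (I j) by exact: loo_window_open.
have Ow (j : J) s : I j s -> Omega_w (eps (tag j)) (loo R (tagged j))
    (ones R (tag j) + (- (tag j)%:R * s) *: delta_mx 0 (tagged j)).
  exact: loo_window_Omega_w.
have cO j s : I j s -> Omega (c j s).
  by move=> /Ow Os; exact: (hat_Omega (@hull_Omega _ (tagged j)) Os).
have line0 (j : J) :
    ones R (tag j) + (- (tag j)%:R * 0) *: delta_mx 0 (tagged j) =
    ones R (tag j) by rewrite mulr0 scale0r addr0.
have wk (j : J) s : I j s -> wdist
    (ones R (tag j) + (- (tag j)%:R * s) *: delta_mx 0 (tagged j))
    (ones R (tag j)) <= kappa.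
  move=> Is; rewrite -[X in wdist _ X](line0 j) wdist_line// subr0.
  exact: loo_window_bounded Is.
have cF j s : I j s -> F j (c j s) = s *: gj j (c j s).
  move=> Is; set w := ones R (tag j) + (- (tag j)%:R * s) *: delta_mx 0 (tagged j).
  have Gw : G g (c j s) w = 0 by apply: hat_solves; exact: Ow.
  have := G_subE g (c j s) w (ones R (tag j)); rewrite Gw sub0r => /(congr1 -%R).
  rewrite opprK /F => ->; rewrite (bigD1 (tagged j))//= big1 => [|i /negbTE ni].
    rewrite !mxE !eqxx/= mulr1 addr0 addrAC subrr add0r scalerA -scaleNr.
    congr (_ *: _); rewrite mulNr mulrN opprK mulKf//.
    by rewrite pnatr_eq0 -lt0n.
  by rewrite !mxE ni andbF mulr0 addr0 subrr scale0r.
have lip (j : J) s s' : I j s -> I j s' ->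
    `|c j s - c j s'| <= B * D%:R / b * `|s - s'|.
  move=> Is Is'; rewrite -(wdist_line (tagged j) _ _ (J_gt0 j)).
  apply: (hat_lipschitz Omega_open g_Ck b0 B0 gB0 _ _ _
    (Ow j s Is) (Ow j s' Is') (wk j s Is)).
  - by move=> w th v; exact: coercive.
  - exact: hat_solves.
  - exact: hull_Omega.
have cc j s : I j s -> {for s, continuous (c j)}.
  move=> Is; apply/cvgrPdist_lt => r r0; pose L := B * D%:R / b.
  have L0 : 0 <= L by rewrite divr_ge0 ?mulr_ge0// ltW.
  have s0 : 0 < r / (L + 1) by rewrite divr_gt0// ltr_wpDl.
  near=> t; have It : I j t by near: t; exact: (open_nbhs_nbhs (conj (Io j) Is)).
  apply: le_lt_trans (lip j s t Is It) _; rewrite -/L.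
  have : `|s - t| < r / (L + 1) by near: t; exact: cvgr_dist_lt.
  rewrite ltr_pdivlMr ?ltr_wpDl// mulrC; apply: le_lt_trans.
  by rewrite ler_wpM2r// lerDl.
have FC1 j : Ck_on 1 Omega (F j).
  by apply: Ck_on_le (Ck_on_G Omega_open g_Ck _).
have FCk i : unif_Ck Omega K (fun j => dpartial [:: i] (F j)).
  split=> [j|s sK]; first by apply: Ck_on_partial; exact: (Ck_on_G Omega_open g_Ck).
  exists (M (size s).+1) => j x l Ux; rewrite -dpartial_rcons.
  have st : size (rcons s i) == (size s).+1 by rewrite size_rcons.
  apply: le_trans (G_bounded (J_gt0 j) (k := (size s).+1) sK Ux).
  exact: (norm_entry_le_norm2 (darray _ _) (Tuple st, l)).
have gCk : unif_Ck Omega K.+1 gj.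
  split=> [j|s sK]; first exact: g_Ck.
  have [C _ gC] := partial_bound gamma_fin sK.
  by exists C => j x i Ux; exact: gC.
have Abnd : exists B : R, forall j s, I j s -> `|s| <= B.
  by exists kappa => j s; exact: loo_window_bounded.
have [dc [cdc dcK]] := implicit_unif_diff Omega_open Io Abnd cO cF cc FC1 FCk gCk b0
  (fun j s v Is => coercive' (tag j) (tagged j) (c j s) v s (J_gt0 j) (cO j s Is)
     (loo_window_bounded Is)).
have /choice[C CP] i : exists C : R, forall j h, 0 <= h ->
    (forall s, 0 <= s <= h -> I j s) ->
    `|c j h 0 i - (taylor_poly K (fun t => c j t 0 i)).[h]| <= C * h ^+ K.+1.
  by have [C _ CP] := taylor_remainder Io (cdc i) (dcK i); exists C.
(* From this rank on [1/N < kappa], so that the window contains [0, 1/N]. *)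
exists (\sum_i C i), (Num.truncn kappa^-1).+1 => N n NN0.
have N0 : (0 < N)%N by exact: leq_trans NN0.
have N0R : 0 < N%:R :> R by rewrite ltr0n.
have Nk : N%:R^-1 < kappa.
  rewrite invf_plt ?posrE//; apply: lt_le_trans (truncnS_gt _) _.
  by rewrite ler_nat.
pose j : J := Tagged (fun N => 'I_N) n.
have Ij s : 0 <= s <= N%:R^-1 -> I j s by exact: loo_window_sub.
have Ij0 : I j 0 by apply: Ij; rewrite lexx invr_ge0 ltW.
have hatE : hat (loo R n) = c j N%:R^-1.
  by rewrite /c /loo_path loo_ones mulNr mulfV ?scaleN1r// gt_eqF.
apply: le_trans (vnorm_le_sum _) _; rewrite mulr_suml; apply: ler_sum => i _.
rewrite mxE [(- _ : 'rV_D) 0 i]mxE distrC -exprVn hatE.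
rewrite (_ : theta_IJ _ _ _ _ 0 i =
             (taylor_poly K (fun t => c j t 0 i)).[N%:R^-1]).
  by apply: CP; rewrite ?invr_ge0 ?ltW.
set br := branch g (hat (ones R N)) (ones R N).
have br_near : \forall w \near ones R N, br w = hat w.
  apply: (branch_near_ones Omega_open g_Ck b0 k0 B0 gB0 _ _ _
    (hull_Omega n)) => //.
  - by move=> w th v; exact: coercive.
  - exact: hat_solves.
have [r /= r0 br_ball] := (nbhs_ballP _ _).1 br_near.
(* The radius in [s] for which the weights stay in the ball where the branch is
   the selected solution. *)
pose U := I j `&` ball (0 : R) (r / N%:R).
have Uo : open U by apply: openI; [exact: Io|exact: ball_open].
have U0 : U 0 by split=> //; apply: ballxx; rewrite divr_gt0.
have brU s : U s -> br (ones R N + (- N%:R * s) *: delta_mx 0 n) = c j s.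
  move=> [_]; rewrite -ball_normE /= sub0r normrN ltr_pdivlMr// => sr.
  apply: br_ball; rewrite -ball_normE /= opprD addrA subrr sub0r normrN.
  apply: le_lt_trans (norm_le_vnorm _) _.
  by rewrite vnormZ vnorm_delta mulr1 normrM normrN normr_nat mulrC.
have brk k : (k <= K)%N -> dpartial (nseq k n) br (ones R N) 0 i =
    (- N%:R)^-1 ^+ k * derive1n k (fun t => c j t 0 i) 0.
  move=> kK; rewrite -[in LHS](line0 j).
  apply: (dpartial_line (U := U)) => //; first by rewrite oppr_eq0 gt_eqF.
  move=> l s i' lk [Is _].
  exact: (unif_diff_derivable Io (cdc i') (dcK i') (leq_trans (ltnW lk) kK)).
rewrite /theta_IJ /taylor_poly horner_poly mxE big_add1/= big_mkord summxE.
rewrite big_ord_recl/= fact0 divr1 mulr1; congr (_ + _).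
  exact: (congr1 (fun w => hat w 0 i) (esym (line0 j))).
apply: eq_bigr => k _; rewrite mxE dirder_loo mxE -/br brk//.
rewrite -[bump 0 k]/(k.+1) -[derive1 _]/(derive1n k.+1 (fun t => c j t 0 i)).
rewrite (mulrA ((-1) ^+ _)) -exprMn mulN1r invrN opprK.
by rewrite mulrCA [RHS]mulrC; congr (_ * _); exact: mulrC.
Unshelve. all: by end_near. Qed.

End LeaveOneOut.

(** * The error of the infinitesimal jackknife *)

Theorem proposition3
  (R : realType) (d : measure_display) (T : measurableType d)
  (P : probability T R) (D kIJ : nat) (Omega : set 'rV[R]_D)
  (g : T -> nat -> 'rV[R]_D -> 'rV[R]_D)
  (thetahat : T -> forall N : nat, 'rV[R]_N -> 'rV[R]_D)
  (eps : T -> nat -> R) (Cop : T -> R) (M : T -> nat -> R)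
  (Omega_open : open Omega)
  (g_random : forall (n : nat) (theta : 'rV[R]_D) (i : 'I_D), Omega theta ->
     measurable_fun setT (fun om : T => g om n theta 0 i))
  (eps_gt0 : {ae P, forall om, forall N : nat, 0 < eps om N})
  (gamma_fin : {ae P, forall om, forall k : nat, (k <= kIJ.+1)%N ->
     (forall n : nat, (1 <= n)%N -> (gamma k Omega (g om n) < +oo)%E) /\
     (ereal_sup [set gamma k Omega (g om n) | n in [set n | (1 <= n)%N]]
        < +oo)%E})
  (hyp1 : {ae P, forall om, forall (N : nat) (w : 'rV[R]_N), Wloo w ->
     (forall w' : 'rV[R]_N, Omega_w (eps om N) w w' ->
        G (g om) (thetahat om N w') w' = 0) /\
     contains_neighborhood Omega
       (convex_hull (thetahat om N @` Omega_w (eps om N) w))})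
  (hyp2 : {ae P, forall om, forall (N : nat) (w : 'rV[R]_N), Wloo w ->
     forall n : nat, (n <= N)%N -> Ck_on kIJ.+1 Omega (g om n)})
  (hyp3 : {ae P, forall om, forall (N : nat) (w : 'rV[R]_N), Wloo w ->
     forall theta : 'rV[R]_D, Omega theta ->
       sym_posdef (H (g om) theta (ones R N)) /\
       (opnorm (invmx (H (g om) theta (ones R N))) <= (Cop om)%:E)%E})
  (hyp4 : {ae P, forall om, forall (N : nat) (w : 'rV[R]_N), Wloo w ->
     forall (k : nat) (theta : 'rV[R]_D), (1 <= k <= kIJ.+1)%N -> Omega theta ->
       norm2 (darray (k := k) (fun th => G (g om) th (ones R N)) theta)
         <= M om k}) :
  {ae P, forall om,
     (fun N : nat => \big[Num.max/0]_(n < N)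
        vnorm (theta_IJ kIJ (g om) (thetahat om N (ones R N)) (loo R n)
               - thetahat om N (loo R n)))
     =O_\oo (fun N : nat => N%:R ^- kIJ.+1 : R^o)}.
Proof.
have loo_Wloo N (n : 'I_N) : Wloo (loo R n) by exists n.
apply: filterS (filterI eps_gt0 (filterI gamma_fin
  (filterI hyp1 (filterI hyp2 (filterI hyp3 hyp4))))).
move=> om [e0 [gam [h1 [h2 [h3 h4]]]]].
have [||||||C [N0 CN0]] := @loo_error R D kIJ Omega (g om) (thetahat om) (eps om)
    (Cop om) (M om) Omega_open e0.
- by move=> k kK; have [] := gam k kK.
- by move=> N n w; have [+ _] := h1 N _ (loo_Wloo N n); exact.
- by move=> N n; have [] := h1 N _ (loo_Wloo N n).
- by move=> n; exact: (h2 n.+1 _ (loo_Wloo n.+1 ord0) n (leqnSn n)).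
- by move=> N theta N0; exact: (h3 N _ (loo_Wloo N (Ordinal N0))).
- by move=> N k theta N0; exact: (h4 N _ (loo_Wloo N (Ordinal N0))).
apply/eqOP; near=> c.
exists N0 => //= N N0N.
have N_ge0 : 0 <= N%:R ^- kIJ.+1 :> R by rewrite invr_ge0 exprn_ge0.
rewrite (ger0_norm N_ge0) ger0_norm; last first.
  by elim/big_ind: _ => // [x y x0 y0|n _]; rewrite ?le_max ?x0// vnorm_ge0.
have C0c : 0 <= c by near: c; exact: nbhs_pinfty_ge.
apply: bigmax_le => [|n _]; first by rewrite mulr_ge0.
apply: le_trans (CN0 N n N0N) _; by rewrite ler_wpM2r.
Unshelve. all: by end_near. Qed.
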